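(* Let $F:\mathbb{C}\to\mathbb{C}^{m\times m}$ be a symmetric, real, rational, C-SSPR transfer function. Then there exists $\varepsilon>0$ such that $G(s):=\frac{F(s)}{s+\varepsilon}+D$ is C-SSNI for any real symmetric matrix $D$. Conversely, let $G:\mathbb{C}\to\mathbb{C}^{m\times m}$ be a symmetric, real, rational, proper, C-SSNI transfer function. Then there exists $\varepsilon>0$ such that $(s+\varepsilon)\,\big(G(s)-G(\infty)\big)$ is C-SSPR.
   Context: $i$ is the imaginary unit; $A^*$ is the conjugate transpose and $A^\top$ the transpose; $\ge0$ (likewise $\le0$) denotes positive semidefiniteness of Hermitian matrices. A rational transfer function is real if its entries are rational functions with real coefficients, symmetric if it equals its transpose, and proper if its value at $\infty$ is finite. A function analytic or harmonic in a region $\Omega$ has full normal rank if its determinant is nonzero at some point of $\Omega$. C-PR (continuous positive real): $F$ is analytic in $\{\mathrm{Re}\,s>0\}$, $F(s)$ is real when $s$ is real and positive, and $F(s)+F(s)^*\ge0$ for all $s$ with $\mathrm{Re}\,s>0$. C-SSPR (continuous strongly strictly positive real): a real transfer function $F$ such that, for some $\epsilon>0$, $s\mapsto F(s-\epsilon)$ is C-PR, and $F(s)+F(-s)^\top$ has full normal rank. C-NI (continuous negative imaginary): $G$ is analytic in $\{\mathrm{Re}\,s>0\}$ and, for all $s$ with $\mathrm{Re}\,s>0$: $i[G(s)-G(s)^*]\ge0$ if $\mathrm{Im}\,s>0$; $i[G(s)-G(s)^*]=0$ if $\mathrm{Im}\,s=0$; $i[G(s)-G(s)^*]\le0$ if $\mathrm{Im}\,s<0$.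 C-SSNI (continuous strongly strictly negative imaginary): a real transfer function $G$ such that, for some $\epsilon>0$, $s\mapsto G(s-\epsilon)$ is C-NI, and $i[G(s)-G(-s)^\top]$ has full normal rank. *)

(* Defs.v *)
From HB Require Import structures.
From mathcomp Require Import all_boot all_order all_algebra.
From mathcomp Require Import complex.
From mathcomp Require Import all_classical all_reals all_analysis.
Set Implicit Arguments.
Unset Strict Implicit.
Unset Printing Implicit Defensive.
Import Order.TTheory GRing.Theory Num.Theory Num.Def.
Import numFieldNormedType.Exports.
Local Open Scope classical_set_scope.
Local Open Scope ring_scope.
Local Open Scope sesquilinear_scope.
Local Open Scope complex_scope.

Section TransferFunctions.
Context {R : realType} {m : nat}.
Local Notation C := R[i].
Implicit Types F G H : C -> 'M[C]_m.

Definition psdmx (A : 'M[C]_m) : Prop :=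
  A \is hermsymmx /\ forall v : 'cV[C]_m, 0 <= (v ^t* *m A *m v) 0 0.

(* [C^o] carries the normed-module structure over [C] itself, so [derivable]
   is complex differentiability. *)
Definition analytic_at F (s : C) : Prop :=
  \forall z \near (s : C^o), forall i j,
    derivable ((fun w => F w i j) : C^o -> C^o) z 1.

Definition horner_C (p : {poly R}) (s : C) : C :=
  (map_poly (real_complex R) p).[s].

(* A transfer function is a total function on [C]; its values at the finitely
   many zeros of the chosen denominators are left unconstrained here, and
   wherever they matter they are pinned down by analyticity. *)
Definition real_rational F : Prop :=
  forall i j, exists p q : {poly R}, q != 0 /\
    forall s, horner_C q s != 0 -> F s i j = horner_C p s / horner_C q s.

Definition symmetric_tf F : Prop := forall s, (F s)^T = F s.

(* The value of [G] at infinity is the value of [z |-> G (1 / z)] at 0. *)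
Definition proper_tf G : Prop :=
  forall i j, cvg ((G z^-1 i j : C^o) @[z --> (0 : C^o)^']).

Definition value_at_infty G : 'M[C]_m :=
  \matrix_(i, j) lim ((G z^-1 i j : C^o) @[z --> (0 : C^o)^']).

(* The region is the domain of analyticity of [H]; for a rational [H] this is
   the complement of a finite set, hence connected. *)
Definition full_normal_rank H : Prop :=
  exists s, analytic_at H s /\ \det (H s) != 0.

Definition C_PR F : Prop :=
  [/\ forall s, 0 < complex.Re s -> analytic_at F s,
      forall x : R, 0 < x -> forall i j, complex.Im (F x%:C i j) = 0
    & forall s, 0 < complex.Re s -> psdmx (F s + (F s) ^t*)].

Definition C_SSPR F : Prop :=
  [/\ real_rational F,
      exists2 eps : R, 0 < eps & C_PR (fun s => F (s - eps%:C))
    & full_normal_rank (fun s => F s + (F (- s))^T)].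

Definition C_NI G : Prop :=
  (forall s, 0 < complex.Re s -> analytic_at G s) /\
  forall s, 0 < complex.Re s ->
    [/\ 0 < complex.Im s -> psdmx ('i%C *: (G s - (G s) ^t*)),
        complex.Im s = 0 -> 'i%C *: (G s - (G s) ^t*) = 0
      & complex.Im s < 0 -> psdmx (- ('i%C *: (G s - (G s) ^t*)))].

Definition C_SSNI G : Prop :=
  [/\ real_rational G,
      exists2 eps : R, 0 < eps & C_NI (fun s => G (s - eps%:C))
    & full_normal_rank (fun s => 'i%C *: (G s - (G (- s))^T))].

End TransferFunctions.

(* Main.v *)
Require Import Defs.
From HB Require Import structures.
From mathcomp Require Import all_boot all_order all_algebra.
From mathcomp Require Import complex.
From mathcomp Require Import all_classical all_reals all_analysis.
From mathcomp Require Import ring lra.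
Set Implicit Arguments.
Unset Strict Implicit.
Unset Printing Implicit Defensive.
Import Order.TTheory GRing.Theory Num.Theory.
Import numFieldNormedType.Exports.
Local Open Scope classical_set_scope.
Local Open Scope ring_scope.
Local Open Scope sesquilinear_scope.
Local Open Scope complex_scope.

(** Everything reduces to scalar functions: for a vector [v], the function
    [f s = (v^H) F(s) v], where [v^H] is the conjugate transpose of [v], is
    rational, and the real part of [f] and the imaginary part of the
    corresponding form of [G] are, up to a factor 2, the forms of [F + F^H] and
    of [i (G - G^H)] with the appropriate sign.

    From [F] to [G].  Let [F] be positive real on [Re s > - e].  By the
    Schwarz-Pick lemma a positive real function [g] satisfies
    [|arg g(w)| <= |arg w|] (lemma [positive_real_angle]); with [w = s + e] this
    bounds the argument of [f(s)] by that of [s + e], hence by that of [s + d]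
    for any [d < e], so that [f(s) / (s + d)] has nonpositive imaginary part in
    the upper half-plane and nonnegative imaginary part in the lower one.  A
    real symmetric [D] contributes a real constant.

    From [G] to [F].  Let [G] be negative imaginary on [Re s > - e], let
    [d < e], and let [h] be the form of [G - G(oo)].  In the variable
    [w = s + d], the real part of [w h] on the imaginary axis is
    [- Im w * Im h >= 0], and [w h] is bounded at infinity because [h] vanishes
    there.  The minimum principle gives [Re (w h) >= 0] on [Re w >= 0] (lemma
    [positive_on_half_plane]).

    The rank conditions are examined at a generic point of the imaginary axis,
    where the matrices in question are positive semidefinite Hermitian
    matrices.  The new one is a combination, with positive weights, of a
    positive definite one and a positive semidefinite one, because the
    estimates above still hold for a larger shift; hence it is invertible.

    All functions are rational, so that the complex analysis needed is
    elementary: the minimum principle for the real part of a quotient of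
    polynomials on a disc follows from compactness and from the leading term
    of the increment at a point, and the Schwarz lemma follows from it.  The
    half-plane and infinity are reached by a Cayley transform, performed on
    polynomials by homogenization. *)

(** * Homogenized polynomials *)

Section Homogenization.
Variable K : fieldType.
Implicit Types (p a b : {poly K}) (s : K).

(** The degree-[n] homogenization of [p] at the pair [(a, b)]: the polynomial
    form of [b ^ n * p (a / b)].  It carries [p] through a Moebius change of
    variable [a / b], and stays meaningful where [b] vanishes, that is, where
    the variable of [p] is infinite. *)
Definition homog n p a b : {poly K} :=
  \sum_(k < n.+1) p`_k *: (a ^+ k * b ^+ (n - k)).

Lemma horner_homog n p a b s : (size p <= n.+1)%N -> b.[s] != 0 ->
  (homog n p a b).[s] = b.[s] ^+ n * p.[a.[s] / b.[s]].
Proof.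
move=> sp bs; rewrite (horner_coef_wide _ sp) horner_sum mulr_sumr.
apply: eq_bigr => k _; rewrite !hornerE.
rewrite expr_div_n expfB_cond ?(negbTE bs) ?add0n -1?ltnS//.
by rewrite /=; ring.
Qed.

Lemma horner_homog0 n p a b s : b.[s] = 0 -> (homog n p a b).[s] = p`_n * a.[s] ^+ n.
Proof.
move=> bs; rewrite horner_sum big_ord_recr /= big1 => [|k _]; last first.
  by rewrite !hornerE bs expr0n subn_eq0 leqNgt ltn_ord /= mulr0.
by rewrite add0r subnn !hornerE /= mulr1.
Qed.

End Homogenization.

(** * Rational functions *)

Section RationalFunctions.
Variable K : numFieldType.
Implicit Types (f g : K -> K) (s z : K) (p q : {poly K}).
Local Notation cont f s := (continuous_at (s : K^o) (f : K^o -> K^o)).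

Lemma cont_cst (c : K) s : cont (fun=> c) s.
Proof. exact: (@cst_continuous K^o K^o c s). Qed.

Lemma contD f g s : cont f s -> cont g s -> cont (fun z => f z + g z) s.
Proof. by move=> cf cg; apply: (cvgD cf cg). Qed.

Lemma contM f g s : cont f s -> cont g s -> cont (fun z => f z * g z) s.
Proof. by move=> cf cg; apply: (cvgM cf cg). Qed.

Lemma cvg_addc T (F : set_system T) {FF : Filter F} (h : T -> K) (l c : K) :
  h t @[t --> F] --> (l : K^o) -> h t + c @[t --> F] --> (l + c : K^o).
Proof. by move=> hl; apply: (cvgD hl); exact: cvg_cst. Qed.

Lemma cont_horner p s : cont (horner p) s.
Proof.
elim/poly_ind: p => [|p c ih].
  have -> : horner (0 : {poly K}) = cst 0 by apply/funext => z; rewrite horner0.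
  exact: cont_cst.
have -> : horner (p * 'X + c%:P) = (fun z => p.[z] * z + c).
  by apply/funext => z; rewrite !hornerE.
apply: contD; last exact: cont_cst.
by apply: contM => //; apply: cvg_id.
Qed.

Lemma near_horner_neq0 p s : p.[s] != 0 -> \forall z \near (s : K^o), p.[z] != 0.
Proof.
move=> ps0; have : (fun z : K^o => p.[z] : K^o) @ s --> (p.[s] : K^o).
  exact: cont_horner.
by move=> /cvgr_neq0; apply.
Qed.

Lemma dnbhs_horner_neq0 p s : p != 0 ->
  \forall z \near (s : K^o)^'%classic, p.[z] != 0.
Proof.
move=> p0; have [m [u /implyP/(_ p0)]] := multiplicity_XsubC p s.
rewrite rootE => us0 ->.
have us := near_horner_neq0 us0; near=> z.
rewrite !hornerE mulf_neq0//; first by near: z; exact: nbhs_dnbhs.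
rewrite expf_neq0 // subr_eq0; near: z; exact: nbhs_dnbhs_neq.
Unshelve. all: by end_near. Qed.

Lemma cont_dnbhs f s : cont f s -> f z @[z --> (s : K^o)^'] --> (f s : K^o).
Proof. by move=> cf; apply: cvg_within_filter. Qed.

(** The roots of [q] are isolated, so two functions that agree off them have
    the same limit at every point. *)
Lemma eq_off_roots f g q s : q != 0 -> cont f s -> cont g s ->
  (\forall z \near (s : K^o), q.[z] != 0 -> f z = g z) -> f s = g s.
Proof.
move=> q0 cf cg /nbhs_dnbhs fg.
have fs : f z @[z --> (s : K^o)^'] --> (f s : K^o) by exact: cont_dnbhs.
have gs : f z @[z --> (s : K^o)^'] --> (g s : K^o).
  have gs' : g z @[z --> (s : K^o)^'] --> (g s : K^o) by exact: cont_dnbhs.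
  apply: cvg_trans gs'; apply: near_eq_cvg; near=> z.
  have qz : q.[z] != 0 by near: z; exact: dnbhs_horner_neq0.
  have : q.[z] != 0 -> f z = g z by near: z.
  by move=> /(_ qz) ->.
exact: (cvg_unique (@norm_hausdorff K K^o) fs gs).
Unshelve. all: by end_near. Qed.

Lemma cvg_horner_quot T (F : set_system T) {FF : Filter F}
    p q (f : T -> K) (l : K) : q.[l] != 0 ->
  f t @[t --> F] --> (l : K^o) ->
  p.[f t] / q.[f t] @[t --> F] --> (p.[l] / q.[l] : K^o).
Proof.
move=> ql fl; have cp r : (r.[f t] : K^o) @[t --> F] --> (r.[l] : K^o).
  exact: (cvg_comp _ _ fl (@cont_horner r l)).
exact: (cvgM (cp p) (cvgV ql (cp q))).
Qed.

(** No value is imposed at the roots of the chosen denominator, so that sums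
    and products of such functions are again of this form. *)
Definition ratf f :=
  exists p q, q != 0 /\ forall s, q.[s] != 0 -> f s = p.[s] / q.[s].

Lemma ratf_cst c : ratf (fun=> c).
Proof. by exists c%:P, 1; split=> [|s _]; rewrite ?oner_eq0// !hornerE divr1. Qed.

Lemma ratfD f g : ratf f -> ratf g -> ratf (fun s => f s + g s).
Proof.
move=> [p [q [q0 fE]]] [p' [q' [q'0 gE]]].
exists (p * q' + p' * q), (q * q'); split=> [|s]; first exact: mulf_neq0.
rewrite !hornerE mulf_eq0 negb_or => /andP[qs q's].
by rewrite fE// gE// addf_div.
Qed.

Lemma ratfM f g : ratf f -> ratf g -> ratf (fun s => f s * g s).
Proof.
move=> [p [q [q0 fE]]] [p' [q' [q'0 gE]]].
exists (p * p'), (q * q'); split=> [|s]; first exact: mulf_neq0.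
rewrite !hornerE mulf_eq0 negb_or => /andP[qs q's].
by rewrite fE// gE// mulf_div.
Qed.

Lemma ratf_sum (I : Type) (r : seq I) (P : pred I) (h : I -> K -> K) :
  (forall i, ratf (h i)) -> ratf (fun s => \sum_(i <- r | P i) h i s).
Proof.
move=> hr; elim: r => [|i r ih].
  by under [X in ratf X]eq_fun do rewrite big_nil; exact: ratf_cst.
under [X in ratf X]eq_fun do rewrite big_cons.
by case: (P i) => //; exact: ratfD.
Qed.

Lemma ratf_prod (I : Type) (r : seq I) (P : pred I) (h : I -> K -> K) :
  (forall i, ratf (h i)) -> ratf (fun s => \prod_(i <- r | P i) h i s).
Proof.
move=> hr; elim: r => [|i r ih].
  by under [X in ratf X]eq_fun do rewrite big_nil; exact: ratf_cst.
under [X in ratf X]eq_fun do rewrite big_cons.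
by case: (P i) => //; exact: ratfM.
Qed.

Lemma ratf_opp f : ratf f -> ratf (fun s => f (- s)).
Proof.
move=> [p [q [q0 fE]]]; exists (p \Po - 'X), (q \Po - 'X); split.
  by rewrite comp_poly2_eq0 // size_polyN size_polyX.
by move=> s; rewrite !horner_comp !hornerE => /fE.
Qed.

Lemma ratf_det n (H : K -> 'M[K]_n) :
  (forall i j, ratf (fun s => H s i j)) -> ratf (fun s => \det (H s)).
Proof.
move=> Hr; apply: ratf_sum => t; apply: ratfM; first exact: ratf_cst.
by apply: ratf_prod => i; exact: Hr.
Qed.

Lemma cvg_sum T (F : set_system T) {FF : Filter F} (I : Type) (r : seq I)
    (P : pred I) (h : I -> T -> K) (l : I -> K) :
  (forall i, h i t @[t --> F] --> (l i : K^o)) ->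
  \sum_(i <- r | P i) h i t @[t --> F] --> (\sum_(i <- r | P i) l i : K^o).
Proof.
move=> hl; apply: cvg_big => // -[a b].
by apply: cvgD; [exact: cvg_fst|exact: cvg_snd].
Qed.

Lemma cvg_prod T (F : set_system T) {FF : Filter F} (I : Type) (r : seq I)
    (P : pred I) (h : I -> T -> K) (l : I -> K) :
  (forall i, h i t @[t --> F] --> (l i : K^o)) ->
  \prod_(i <- r | P i) h i t @[t --> F] --> (\prod_(i <- r | P i) l i : K^o).
Proof.
move=> hl; apply: cvg_big => // -[a b].
by apply: cvgM; [exact: cvg_fst|exact: cvg_snd].
Qed.

Lemma cvg_det T (F : set_system T) {FF : Filter F} n (H : T -> 'M[K]_n)
    (L : 'M[K]_n) :
  (forall i j, H t i j @[t --> F] --> (L i j : K^o)) ->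
  \det (H t) @[t --> F] --> (\det L : K^o).
Proof.
move=> HL; apply: cvg_sum => s; apply: cvgM; first exact: cvg_cst.
by apply: cvg_prod => i; exact: HL.
Qed.

Lemma cont_det n (H : K -> 'M[K]_n) s :
  (forall i j, cont (fun z => H z i j) s) -> cont (fun z => \det (H z)) s.
Proof. exact: (@cvg_det _ (nbhs (s : K^o)) _ n H (H s)). Qed.

(** After division by the gcd, a root of the denominator is not a root of the
    numerator; it would be a pole, which continuity excludes on [Om].  Hence
    one quotient represents the function at every point of [Om]. *)
Lemma ratf_reduce f (Om : K -> Prop) : ratf f -> (forall s, Om s -> cont f s) ->
  exists p q r, r != 0 /\
    forall s, r.[s] != 0 \/ Om s -> q.[s] != 0 /\ f s = p.[s] / q.[s].
Proof.
move=> [p [q [q0 fE]]] cf.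
pose d := gcdp p q; pose p' := p %/ d; pose q' := q %/ d.
have pE : p = p' * d by rewrite divpK// dvdp_gcdl.
have qE : q = q' * d by rewrite divpK// dvdp_gcdr.
have cop : coprimep p' q' by rewrite coprimep_div_gcd// q0 orbT.
have fE' s : q.[s] != 0 -> q'.[s] != 0 /\ f s = p'.[s] / q'.[s].
  move=> qs; rewrite (fE _ qs); move: qs; rewrite pE qE !hornerE => /[dup].
  rewrite {1}mulf_eq0 negb_or => /andP[q's ds] _; split => //.
  by rewrite -mulf_div divff// mulr1.
exists p', q', q; split=> // s [/fE'//|Oms].
have fq : f s * q'.[s] = p'.[s].
  apply: (@eq_off_roots (fun z => f z * q'.[z]) _ q s q0).
  - by apply: contM; [exact: cf|exact: cont_horner].
  - exact: cont_horner.
  by apply: filterE => z /fE'[q'z ->]; rewrite divfK.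
have q's : q'.[s] != 0.
  apply/negP => /eqP q's; move: fq; rewrite q's mulr0 => /esym/eqP p's.
  by move: (coprimep_root cop p's); rewrite q's eqxx.
by split=> //; rewrite -fq mulfK.
Qed.

(** In the variable [1 / z], numerator and denominator become their reversed
    polynomials, whose values at 0 are the leading coefficients (or 0, for the
    polynomial of smaller degree).  If [p] had the larger or an equal degree,
    the limit at infinity would exclude a nonzero leading coefficient of [p]. *)
Lemma size_ratf_infty f p q (r : {poly K}) : r != 0 ->
  (forall s, r.[s] != 0 -> q.[s] != 0 /\ f s = p.[s] / q.[s]) ->
  f z^-1 @[z --> (0 : K^o)^'] --> (0 : K^o) -> (size p < size q)%N.
Proof.
move=> r0 fE f0; rewrite ltnNge; apply/negP => spq.
have hX : ('X : {poly K}).[0] = 0 by rewrite hornerX.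
have q0 : q != 0.
  near (0 : K^o)^' => z.
  have /fE[qz _] : r.[z] != 0 by near: z; exact: dnbhs_horner_neq0.
  by apply: contraNneq qz => ->; rewrite horner0.
have p0 : p != 0 by rewrite -size_poly_gt0 (leq_trans _ spq)// size_poly_gt0.
pose n := (size p).-1; have nE : size p = n.+1 by rewrite prednK ?size_poly_gt0.
pose m := (size r).-1; have mE : size r = m.+1 by rewrite prednK ?size_poly_gt0.
have near_r : \forall z \near (0 : K^o)^', (homog m r 1 'X).[z] != 0.
  apply: nbhs_dnbhs; apply: near_horner_neq0.
  by rewrite horner_homog0// !hornerE expr1n mulr1 -lead_coefE lead_coef_eq0.
pose p' := homog n p 1 'X; pose q' := homog n q 1 'X.
have lim : f z^-1 * q'.[z] @[z --> (0 : K^o)^'] --> (0 * q'.[0] : K^o).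
  have cq : q'.[z] @[z --> (0 : K^o)^'] --> (q'.[0] : K^o).
    by exact/cont_dnbhs/cont_horner.
  exact: (cvgM f0 cq).
have lim' : f z^-1 * q'.[z] @[z --> (0 : K^o)^'] --> (p'.[0] : K^o).
  have cp : p'.[z] @[z --> (0 : K^o)^'] --> (p'.[0] : K^o).
    by exact/cont_dnbhs/cont_horner.
  apply: cvg_trans cp; apply: near_eq_cvg; near=> z.
  have z0 : ('X : {poly K}).[z] != 0.
    by rewrite hornerX; near: z; exact: nbhs_dnbhs_neq.
  have : (homog m r 1 'X).[z] != 0 by near: z.
  rewrite /p' /q' !horner_homog ?mE ?nE // -?nE // !hornerE mulf_eq0 negb_or.
  by move=> /andP[_ /fE[qz ->]] /=; field.
have : 0 * q'.[0] = p'.[0].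
  exact: (cvg_unique (@norm_hausdorff K K^o) lim lim').
rewrite mul0r /p' horner_homog0// !hornerE expr1n mulr1 -lead_coefE.
by move/esym/eqP; rewrite lead_coef_eq0 (negbTE p0).
Unshelve. all: by end_near. Qed.

End RationalFunctions.

(** * Real and imaginary parts *)

Section ComplexPlane.
Variable R : realType.
Local Notation C := (R[i]).
Local Notation Re := (@complex.Re R).
Local Notation Im := (@complex.Im R).
Implicit Types (z w s : C) (p q : {poly C}).

(** The squared modulus, as an element of [R] rather than of [R[i]]: the
    estimates below are then polynomial inequalities over an ordered field. *)
Definition sqn z : R := Re z ^+ 2 + Im z ^+ 2.

Lemma cReD z w : Re (z + w) = Re z + Re w. Proof. by case: z w => [a b] []. Qed.
Lemma cImD z w : Im (z + w) = Im z + Im w. Proof. by case: z w => [a b] []. Qed.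
Lemma cReN z : Re (- z) = - Re z. Proof. by case: z. Qed.
Lemma cImN z : Im (- z) = - Im z. Proof. by case: z. Qed.
Lemma cReM z w : Re (z * w) = Re z * Re w - Im z * Im w.
Proof. by case: z w => [a b] []. Qed.
Lemma cImM z w : Im (z * w) = Re z * Im w + Im z * Re w.
Proof. by case: z w => [a b] []. Qed.
Lemma sqn_norm z : (sqn z)%:C = `|z| ^+ 2. Proof. exact: add_Re2_Im2. Qed.
Lemma sqn_ge0 z : 0 <= sqn z. Proof. by rewrite addr_ge0 ?sqr_ge0. Qed.
Lemma sqnM z w : sqn (z * w) = sqn z * sqn w.
Proof. by rewrite /sqn cReM cImM; ring. Qed.
Lemma sqn_gt0 z : z != 0 -> 0 < sqn z.
Proof. by move=> z0; rewrite -ltcR sqn_norm exprn_gt0 // normr_gt0. Qed.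
Lemma sqn0 : sqn 0 = 0. Proof. by rewrite /sqn /= !expr0n addr0. Qed.
Lemma sqn1 : sqn 1 = 1. Proof. by rewrite /sqn /= expr0n addr0 expr1n. Qed.
Lemma sqnV z : sqn z^-1 = (sqn z)^-1.
Proof.
have [->|z0] := eqVneq z 0; first by rewrite invr0 sqn0 invr0.
have : sqn z * sqn z^-1 = 1 by rewrite -sqnM divff// sqn1.
by move=> /(canRL (mulKf (lt0r_neq0 (sqn_gt0 z0)))) ->; rewrite mulr1.
Qed.
Lemma cvg_Re T (F : set_system T) {FF : Filter F} (f : T -> C) (l : C) :
  f t @[t --> F] --> (l : C^o) -> (Re (f t) : R) @[t --> F] --> Re l.
Proof.
move=> fl; apply/cvgrPdist_lt => e e0.
have e0' : 0 < e%:C by rewrite ltcR.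
near=> t; rewrite -ltcR -cReN -cReD (le_lt_trans (normc_ge_Re _))//.
by near: t; apply: (@cvgr_dist_lt _ C^o).
Unshelve. all: by end_near. Qed.

Lemma cvg_Im T (F : set_system T) {FF : Filter F} (f : T -> C) (l : C) :
  f t @[t --> F] --> (l : C^o) -> (Im (f t) : R) @[t --> F] --> Im l.
Proof.
move=> fl; apply/cvgrPdist_lt => e e0.
have e0' : 0 < e%:C by rewrite ltcR.
have normc_ge_Im z : `|Im z|%:C <= `|z|.
  by rewrite normc_def lecR -sqrtr_sqr ler_wsqrtr // lerDr sqr_ge0.
near=> t; rewrite -ltcR -cImN -cImD (le_lt_trans (normc_ge_Im _))//.
by near: t; apply: (@cvgr_dist_lt _ C^o).
Unshelve. all: by end_near. Qed.

Lemma cvg_sqn T (F : set_system T) {FF : Filter F} (f : T -> C) (l : C) :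
  f t @[t --> F] --> (l : C^o) -> sqn (f t) @[t --> F] --> sqn l.
Proof.
by move=> fl; apply: cvgD; apply: cvgM; do ?[exact: cvg_Re|exact: cvg_Im].
Qed.

Lemma cvg_complex T (F : set_system T) {FF : Filter F} (f g : T -> R) (a b : R) :
  f t @[t --> F] --> a -> g t @[t --> F] --> b ->
  (f t +i* g t : C^o) @[t --> F] --> (a +i* b : C^o).
Proof.
move=> fa gb; apply/(@cvgrPdist_lt _ C^o); case=> e e'.
rewrite ltcE /= => /andP[/eqP -> e0].
have e20 : 0 < e / 2 by rewrite divr_gt0.
near=> t.
have h1 : `|a - f t| < e / 2 by near: t; apply: cvgr_dist_lt.
have h2 : `|b - g t| < e / 2 by near: t; apply: cvgr_dist_lt.
rewrite [X in `|X|]complexE (le_lt_trans (ler_normD _ _))// normrM /=.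
rewrite [e +i* 0](_ : _ = (e / 2)%:C + (e / 2)%:C); last first.
  by rewrite -rmorphD /= -splitr.
rewrite ltrD// normc_def /= ?expr0n ?addr0 ?sqrtr_sqr ?ltcR//.
by rewrite normc_def /= expr0n add0r expr1n sqrtr1 mul1r addr0 sqrtr_sqr ltcR.
Unshelve. all: by end_near. Qed.

Lemma cvg_real T (F : set_system T) {FF : Filter F} (f : T -> R) (a : R) :
  f t @[t --> F] --> a -> ((f t)%:C : C^o) @[t --> F] --> (a%:C : C^o).
Proof. by move=> fa; apply: cvg_complex => //; exact: cvg_cst. Qed.

Lemma cvg_line (s eta : C) :
  (s + eta * t%:C : C^o) @[t --> (0 : R)^'+] --> (s : C^o).
Proof.
rewrite -[X in _ --> X]addr0 -[X in _ + X](mulr0 eta).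
apply: (@cvgD _ C^o); first exact: cvg_cst.
apply: (@cvgM C); first exact: cvg_cst.
by apply: cvg_real; apply: cvg_at_right_filter; exact: cvg_id.
Qed.

Lemma cvg_Re_quot T (F : set_system T) {FF : Filter F} p q (f : T -> C) l :
  q.[l] != 0 -> f t @[t --> F] --> (l : C^o) ->
  Re (p.[f t] / q.[f t]) @[t --> F] --> Re (p.[l] / q.[l]).
Proof. by move=> ql fl; apply: cvg_Re; exact: (@cvg_horner_quot C). Qed.

End ComplexPlane.

(** * Maximum principle and Schwarz lemma for rational functions *)

Section Disc.
Variable R : realType.
Local Notation C := (R[i]).
Local Notation Re := (@complex.Re R).
Local Notation Im := (@complex.Im R).
Implicit Types (z w s : C) (p q : {poly C}).

(** If a quotient of polynomials is not constant, its increment at [s] starts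
    with a nonzero power of the displacement, and a root of suitable argument
    gives a direction in which the real part decreases. *)
Lemma exists_Re_lt p q s : q.[s] != 0 -> p - (p.[s] / q.[s])%:P * q != 0 ->
  exists eta : C, \forall t \near (0 : R)^'+,
    Re (p.[s + eta * t%:C] / q.[s + eta * t%:C]) < Re (p.[s] / q.[s]).
Proof.
move=> qs; set k0 := p.[s] / q.[s]; set P := p - _ => P0.
have [[|m] [u /implyP/(_ P0)]] := multiplicity_XsubC P s.
  rewrite expr0 mulr1 => us PE; move: us; rewrite -PE rootE !hornerE.
  by rewrite divfK// subrr eqxx.
rewrite rootE => us PE.
(* the direction in which the leading term of the increment is - t ^ m.+1 *)
pose eta := m.+1.-root (- (q.[s] / u.[s])).
have etaX : eta ^+ m.+1 = - (q.[s] / u.[s]) by rewrite rootCK.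
exists eta.
have cl := @cvg_line R s eta.
pose V := (eta ^+ m.+1)%:P * u.
have W0 : Re (V.[s] / q.[s]) < 0.
  rewrite /V !hornerE etaX mulNr divfK// mulNr divff// /=; lra.
have Wn : \forall t \near (0 : R)^'+,
    Re (V.[s + eta * t%:C] / q.[s + eta * t%:C]) < 0.
  exact: (cvgr_lt _ (cvg_Re_quot (p := V) qs cl)).
have qn : \forall t \near (0 : R)^'+, q.[s + eta * t%:C] != 0.
  exact: (cl _ (near_horner_neq0 qs)).
near=> t.
have t0 : 0 < t by near: t; exact: nbhs_right_gt.
have qt : q.[s + eta * t%:C] != 0 by near: t.
have : Re (V.[s + eta * t%:C] / q.[s + eta * t%:C]) < 0 by near: t.
set z := s + eta * t%:C in qt *.
have -> : p.[z] / q.[z] = k0 + (t ^+ m.+1)%:C * (V.[z] / q.[z]).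
  have -> : p = P + k0%:P * q by rewrite subrK.
  rewrite PE /V !hornerE mulrDl mulfK// [RHS]addrC; congr (_ + _).
  by rewrite {2}/z addrC addKr exprMn rmorphXn /=; ring.
rewrite cReD cReM /= mul0r subr0 => Wz.
by rewrite -subr_gt0 opprD addNKr -mulrN mulr_gt0 ?exprn_gt0 ?oppr_gt0.
Unshelve. all: by end_near. Qed.

Lemma compact_disc (r : R) : compact [set t : R * R | t.1 ^+ 2 + t.2 ^+ 2 <= r].
Proof.
have cK : compact (`[- (1 + r), 1 + r]%classic `*`
                   `[- (1 + r), 1 + r]%classic : set (R * R)).
  by apply: compact_setX; exact: segment_compact.
apply: (subclosed_compact _ cK).
  have cf : continuous (fun t : R * R => t.1 ^+ 2 + t.2 ^+ 2).
    by move=> t; apply: cvgD; apply: cvgM; do ?[exact: cvg_fst|exact: cvg_snd].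
  apply: (preimage_closed (D := [set x : R | x <= r]) _ (@closed_le R r)).
  by move=> t _; exact: cf.
move=> [x y] /= xyr; rewrite !in_itv /=.
by do 2?split; nra.
Qed.

(** The minimum of the real part over the compact disc is attained; unless the
    function is constant, it cannot be attained in the interior. *)
Lemma min_disc p q (r : R) :
  0 <= r -> (forall z, sqn z <= r -> q.[z] != 0) ->
  (forall z, sqn z = r -> 0 <= Re (p.[z] / q.[z])) ->
  forall z, sqn z <= r -> 0 <= Re (p.[z] / q.[z]).
Proof.
move=> r0 qr pqr z zr.
pose f (t : R * R) := Re (p.[t.1 +i* t.2] / q.[t.1 +i* t.2]).
pose A := [set t : R * R | t.1 ^+ 2 + t.2 ^+ 2 <= r].
have A0 : A !=set0 by exists (0, 0); rewrite /A /= expr0n addr0.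
have cf : {within A, continuous f}.
  apply: continuous_in_subspaceT => t; rewrite inE => At.
  apply: cvg_Re_quot; first exact: qr.
  by apply: cvg_complex; [exact: cvg_fst|exact: cvg_snd].
have [[x y]] := compact_EVT_min A0 (compact_disc (r := r)) cf.
rewrite inE => Axy fmin.
pose s : C := x +i* y.
have smin w : sqn w <= r -> Re (p.[s] / q.[s]) <= Re (p.[w] / q.[w]).
  by case: w => a b wr; have := fmin (a, b); apply; rewrite inE.
apply: le_trans (smin z zr).
have qs : q.[s] != 0 by exact: qr.
have [/eqP|/(exists_Re_lt qs)[eta eta_lt]] := eqVneq (p - (p.[s] / q.[s])%:P * q) 0.
  rewrite subr_eq0 => /eqP pE.
  pose b : C := (Num.sqrt r)%:C.
  have br : sqn b = r by rewrite /sqn /= expr0n addr0 sqr_sqrtr.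
  have := pqr b br; rewrite [in p.[b]]pE !hornerE mulfK//.
  by rewrite qr// br.
have : sqn s <= r by exact: Axy.
rewrite le_eqVlt => /predU1P[/pqr//|sr].
have : \forall t \near (0 : R)^'+, sqn (s + eta * t%:C) < r.
  exact: (cvgr_lt _ (cvg_sqn (@cvg_line R s eta))).
move=> inside; near (0 : R)^'+ => t.
have /smin : sqn (s + eta * t%:C) <= r by apply: ltW; near: t.
by rewrite leNgt => /negP; case; near: t.
Unshelve. all: by end_near. Qed.

(** With [k] the value of the quotient at [z], this is the previous lemma for
    [sqn k + M - 2 * conj k * (p / q)], whose real part is nonnegative on the
    circle by the inequality [2 * Re (conj a * b) <= sqn a + sqn b]. *)
Lemma max_disc p q (r M : R) :
  0 <= r -> (forall z, sqn z <= r -> q.[z] != 0) ->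
  (forall z, sqn z = r -> sqn p.[z] <= M * sqn q.[z]) ->
  forall z, sqn z <= r -> sqn p.[z] <= M * sqn q.[z].
Proof.
move=> r0 qr pqr z zr; have qz := qr _ zr.
set k := p.[z] / q.[z].
pose g := ((sqn k + M)%:C)%:P * q - ((2 : R)%:C * k^*%C)%:P * p.
have cauchy a b : 2 * Re (a^*%C * b) <= sqn a + sqn b.
  have := sqn_ge0 (a - b); rewrite /sqn cReD cReN cImD cImN cReM.
  by case: a b => [a a'] [b b'] /=; lra.
have ReE w : sqn w <= r ->
    Re (g.[w] / q.[w]) = sqn k + M - 2 * Re (k^*%C * (p.[w] / q.[w])).
  move=> wr; rewrite !(hornerD, hornerN, hornerM, hornerC) mulrBl mulfK ?qr//.
  rewrite cReD cReN -!mulrA [Re ((2 : R)%:C * _)]cReM.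
  by rewrite [Re _%:C]/= [Im _%:C]/= mul0r subr0.
have quot w : sqn w <= r -> sqn p.[w] = sqn (p.[w] / q.[w]) * sqn q.[w].
  by move=> wr; rewrite -sqnM divfK// qr.
have : sqn k <= M; last by move=> kM; rewrite quot// ler_wpM2r// sqn_ge0.
have := @min_disc g q r r0 qr _ z zr.
rewrite ReE// -/k; have -> : Re (k^*%C * k) = sqn k.
  by case: (k) => a b; rewrite /sqn /=; ring.
suff H w : sqn w = r -> 0 <= Re (g.[w] / q.[w]).
  by move=> /(_ H); lra.
move=> wr; have wr' : sqn w <= r by rewrite wr.
rewrite ReE//; have := cauchy k (p.[w] / q.[w]).
suff : sqn (p.[w] / q.[w]) <= M by lra.
have := pqr _ wr; rewrite quot//; rewrite ler_pM2r //.
by apply: sqn_gt0; exact: qr.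
Qed.

(** Dividing by the variable, the maximum principle on the disc of squared
    radius [r] bounds the squared modulus by [1 / r]; then [r] tends
    to 1. *)
Lemma schwarz p q : p.[0] = 0 ->
  (forall z, sqn z < 1 -> q.[z] != 0 /\ sqn p.[z] <= sqn q.[z]) ->
  forall z, sqn z < 1 -> sqn p.[z] <= sqn z * sqn q.[z].
Proof.
move=> /eqP; rewrite -/(root p 0) => /factor_theorem[p1 ->] pq z z1.
rewrite subr0 hornerM hornerX mulrC sqnM ler_wpM2l ?sqn_ge0//.
have bound r : 0 < r -> sqn z <= r -> r < 1 -> r * sqn p1.[z] <= sqn q.[z].
  move=> r0 zr r1; rewrite -ler_pdivlMl//.
  apply: (@max_disc _ _ r) => //; first exact: ltW.
    by move=> w wr; apply: (pq _ _).1; exact: le_lt_trans r1.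
  move=> w wr; rewrite ler_pdivlMl// -wr -sqnM mulrC.
  have [_] := pq w (eq_ind_r (fun x => x < 1) r1 wr).
  by rewrite subr0 hornerM hornerX.
rewrite leNgt; apply/negP => lt1.
set a := sqn p1.[z] in bound lt1; set b := sqn q.[z] in bound lt1.
have b0 : 0 <= b := sqn_ge0 _.
have a0 : 0 < a by exact: le_lt_trans lt1.
(* any r between sqn z and 1 such that b < r * a contradicts [bound] *)
pose r0 := (a + b) / (2 * a).
have ar0 : a * r0 = (a + b) / 2 by rewrite /r0; field; rewrite gt_eqF.
have r01 : r0 < 1 by rewrite /r0 ltr_pdivrMr; lra.
pose r := Num.max (sqn z) r0.
have rr0 : r0 <= r by rewrite le_max lexx orbT.
have r0p : 0 < r0 by rewrite /r0 divr_gt0; lra.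
have := bound r; have -> : r < 1 by rewrite gt_max z1.
rewrite le_max lexx (lt_le_trans r0p rr0) => /(_ isT isT isT); nra.
Qed.

End Disc.

(** * Estimates on the right half-plane *)

Section HalfPlane.
Variable R : realType.
Local Notation C := (R[i]).
Local Notation Re := (@complex.Re R).
Local Notation Im := (@complex.Im R).
Implicit Types (z w s : C) (p q : {poly C}).

Lemma sqnDr (z : C) (x : R) : sqn (z + x%:C) = sqn z + x ^+ 2 + 2 * x * Re z.
Proof. by case: z => a b; rewrite /sqn /=; ring. Qed.

Lemma Re_cayley z : z != 1 ->
  Re ((1 + z) / (1 - z)) = (1 - sqn z) / sqn (1 - z).
Proof.
rewrite eq_sym -subr_eq0 => z1.
have -> : (1 + z) / (1 - z) = (1 + z) * (1 - z)^*%C * ((sqn (1 - z))^-1)%:C.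
  rewrite -mulrA; congr (_ * _); apply: (mulfI z1); rewrite divff//.
  rewrite mulrA -sqr_normc -sqn_norm -rmorphM /= divff//.
  exact/lt0r_neq0/sqn_gt0.
rewrite cReM /= mulr0 subr0; congr (_ * _).
by case: (z) => a b; rewrite /sqn /=; ring.
Qed.

Lemma cayley_half_plane (x : R) z : 0 < x -> sqn z < 1 ->
  1 - z != 0 /\ 0 < Re (x%:C * (1 + z) / (1 - z)).
Proof.
move=> x0 zlt1.
have z1 : z != 1 by apply: contraTneq zlt1 => ->; rewrite sqn1 ltxx.
have z1' : 1 - z != 0 by rewrite subr_eq0 eq_sym.
split=> //; rewrite -mulrA cReM /= mul0r subr0 Re_cayley//.
by rewrite mulr_gt0// divr_gt0 ?sqn_gt0// subr_gt0.
Qed.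

(** The Schwarz lemma for the function that sends the unit disc to the
    half-plane, 0 to [x], then follows [p / q], and returns to the disc by
    the Moebius map that sends [c] to 0. *)
Lemma schwarz_pick p q (x c : R) : 0 < x -> 0 < c ->
  (forall w, 0 < Re w -> q.[w] != 0 /\ 0 <= Re (p.[w] / q.[w])) ->
  p.[x%:C] / q.[x%:C] = c%:C ->
  forall w, 0 < Re w ->
    sqn (w + x%:C) * sqn (p.[w] / q.[w] - c%:C) <=
    sqn (w - x%:C) * sqn (p.[w] / q.[w] + c%:C).
Proof.
move=> x0 c0 pq pqx w w0.
pose pm := p - (c%:C)%:P * q; pose pp := p + (c%:C)%:P * q.
pose n := maxn (size pm) (size pp).
have sm : (size pm <= n.+1)%N by rewrite leqW// leq_maxl.
have sp : (size pp <= n.+1)%N by rewrite leqW// leq_maxr.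
pose a : {poly C} := (x%:C)%:P * (1 + 'X); pose b : {poly C} := 1 - 'X.
have aE z : a.[z] = x%:C * (1 + z) by rewrite !hornerE.
have bE z : b.[z] = 1 - z by rewrite !hornerE.
have x0' : 0 < Re x%:C by [].
have [qx _] := pq _ x0'.
have pmE v : 0 < Re v -> pm.[v] = q.[v] * (p.[v] / q.[v] - c%:C).
  move=> /pq[qv _].
  by rewrite !hornerE mulrBr mulrCA divff// mulr1 [_ * q.[v]]mulrC.
have ppE v : 0 < Re v -> pp.[v] = q.[v] * (p.[v] / q.[v] + c%:C).
  move=> /pq[qv _].
  by rewrite !hornerE mulrDr mulrCA divff// mulr1 [_ * q.[v]]mulrC.
have P0 : (homog n pm a b).[0] = 0.
  rewrite horner_homog// bE ?subr0 ?oner_neq0// aE addr0 mulr1 divr1.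
  by rewrite pmE// pqx subrr !mulr0.
have bound z : sqn z < 1 ->
    (homog n pp a b).[z] != 0 /\
    sqn (homog n pm a b).[z] <= sqn (homog n pp a b).[z].
  move=> z1; have [bz vz] := cayley_half_plane x0 z1.
  rewrite !horner_homog ?bE// aE; set v := _ / _ in vz *.
  rewrite pmE// ppE//; have [qv gv] := pq _ vz; set g := p.[v] / q.[v] in gv *.
  split.
    rewrite mulf_neq0 ?expf_neq0// mulf_neq0//; apply/eqP => /(congr1 Re).
    by rewrite cReD /=; lra.
  rewrite !sqnM !ler_wpM2l ?sqn_ge0// -rmorphN !sqnDr /=; nra.
have wx : w + x%:C != 0.
  by apply/eqP => /(congr1 Re); rewrite cReD /=; lra.
pose z := (w - x%:C) / (w + x%:C).
have zE : sqn z * sqn (w + x%:C) = sqn (w - x%:C) by rewrite -sqnM divfK.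
have wx0 := sqn_gt0 wx.
have z1 : sqn z < 1.
  rewrite -(ltr_pM2r wx0) zE mul1r -rmorphN !sqnDr; nra.
have [bz _] := cayley_half_plane x0 z1.
have wE : a.[z] / b.[z] = w.
  rewrite aE bE; apply: (mulIf bz); rewrite divfK//.
  by rewrite /z; field.
clearbody z.
have := schwarz P0 bound z1.
rewrite !horner_homog ?bE// -bE wE pmE// ppE// !sqnM.
have q0 : 0 < sqn q.[w] by apply: sqn_gt0; have [] := pq _ w0.
have b0 : 0 < sqn (b.[z] ^+ n) by rewrite sqn_gt0// expf_neq0// bE.
rewrite [X in _ <= X]mulrCA ler_pM2l// [X in _ <= X]mulrCA ler_pM2l// => le1.
by rewrite -zE -mulrA [X in _ <= X]mulrCA ler_pM2l.
Qed.

(** A positive real function satisfies [|arg g w| <= |arg w|].  The base point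
    [x = |w|] is the one for which the hyperbolic disc that the Schwarz-Pick
    lemma gives around the real number [c = g x] is exactly tangent to the
    rays of argument [arg w] and [- arg w]. *)
Lemma positive_real_angle p q :
  (forall w, 0 < Re w -> q.[w] != 0 /\ 0 <= Re (p.[w] / q.[w])) ->
  (forall x : R, 0 < x -> Im (p.[x%:C] / q.[x%:C]) = 0) ->
  forall w, 0 < Re w ->
    Re w * `|Im (p.[w] / q.[w])| <= `|Im w| * Re (p.[w] / q.[w]).
Proof.
move=> pq pqx w w0.
have [qw gw] := pq _ w0.
pose x := Num.sqrt (sqn w).
have x2 : x ^+ 2 = sqn w by rewrite sqr_sqrtr// sqn_ge0.
have x0 : 0 < x.
  rewrite sqrtr_gt0 sqn_gt0//; apply/eqP => wE; move: w0; rewrite wE /=; lra.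
(* adding h makes the value at x positive, as the Schwarz-Pick lemma requires *)
suff H (h : R) : 0 < h ->
    Re w * `|Im (p.[w] / q.[w])| <= `|Im w| * (Re (p.[w] / q.[w]) + h).
  apply/ler_addgt0Pr => e e0.
  have e1 : 0 < e / (`|Im w| + 1) by rewrite divr_gt0// ltr_wpDl.
  apply: (le_trans (H _ e1)); rewrite mulrDr lerD2l mulrCA ger_pMr//.
  by rewrite ler_pdivrMr ?mul1r ?ltr_wpDl// lerDl.
move=> h0; pose ph := p + (h%:C)%:P * q.
have phE v : 0 < Re v -> ph.[v] / q.[v] = p.[v] / q.[v] + h%:C.
  by move=> /pq[qv _]; rewrite !hornerE mulrDl mulfK.
have pqh v : 0 < Re v -> q.[v] != 0 /\ 0 <= Re (ph.[v] / q.[v]).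
  move=> v0; have [qv gv] := pq _ v0; split=> //.
  by rewrite phE// cReD /= addr_ge0// ltW.
have x0' : 0 < Re x%:C by [].
pose c := Re (p.[x%:C] / q.[x%:C]) + h.
have c0 : 0 < c by rewrite ltr_wpDl//; have [] := pq _ x0'.
have cE : ph.[x%:C] / q.[x%:C] = c%:C.
  rewrite phE// [p.[_] / _]complexE pqx//= mulr0 addr0 /c.
  by rewrite rmorphD.
have := schwarz_pick x0 c0 pqh cE w0; rewrite phE//.
have -> : Im (p.[w] / q.[w]) = Im (p.[w] / q.[w] + h%:C) by rewrite cImD addr0.
have -> : Re (p.[w] / q.[w]) + h = Re (p.[w] / q.[w] + h%:C) by rewrite cReD.
have : 0 < Re (p.[w] / q.[w] + h%:C) by rewrite cReD ltr_wpDl.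
move: (p.[w] / q.[w] + h%:C) => g g0.
rewrite -!rmorphN !sqnDr -x2 /=.
move: x2; rewrite {1}/sqn.
set A := Re w in w0 *; set B := Im w; set u := Re g in g0 *.
rewrite /sqn -/u; set v := Im g => xAB hyp.
set N := u ^+ 2 + v ^+ 2 in hyp.
have h1 : A * (N + c ^+ 2) <= 2 * x * c * u.
  have x40 : 0 < 4 * x by rewrite mulr_gt0.
  rewrite -(ler_pM2l x40) -subr_ge0.
  move: hyp; rewrite -subr_ge0; congr (0 <= _); ring.
have h2 : A ^+ 2 * N <= x ^+ 2 * u ^+ 2.
  (* compare (N + c ^ 2) ^ 2 with 4 * N * c ^ 2 *)
  have c20 : 0 < 4 * c ^+ 2 by rewrite mulr_gt0// exprn_gt0.
  rewrite -(ler_pM2l c20).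
  have : (A * (N + c ^+ 2)) ^+ 2 <= (2 * x * c * u) ^+ 2.
    have l0 : 0 <= A * (N + c ^+ 2).
      by rewrite mulr_ge0 ?(ltW w0)// !addr_ge0 ?sqr_ge0.
    by rewrite ler_sqr// nnegrE (le_trans l0 h1).
  have h3 := mulr_ge0 (sqr_ge0 A) (sqr_ge0 (N - c ^+ 2)).
  by move=> h4; lra.
rewrite -(@ler_sqr _ (_ * _)) ?nnegrE ?mulr_ge0 ?(ltW w0) ?(ltW g0)//.
rewrite !exprMn !real_normK ?num_real//; move: h2; rewrite xAB /N => h2; lra.
Qed.

Lemma cayley_half_plane_le z : sqn z <= 1 -> z != 1 ->
  0 <= Re ((1 + z) / (1 - z)) /\ (sqn z = 1 -> Re ((1 + z) / (1 - z)) = 0).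
Proof.
move=> zle1 z1; rewrite Re_cayley//; split=> [|->]; last by rewrite subrr mul0r.
by rewrite divr_ge0 ?sqn_ge0// subr_ge0.
Qed.

(** The function [w * (p / q) w] has real part [- b * Im (p / q)] at [i * b],
    and a finite limit at infinity by the condition on degrees.  On the closed
    unit disc it becomes a quotient without pole, to which the minimum
    principle applies. *)
Lemma positive_on_half_plane p q : (size p < size q)%N ->
  (forall w, 0 <= Re w -> q.[w] != 0) ->
  (forall b : R, b * Im (p.[0 +i* b] / q.[0 +i* b]) <= 0) ->
  forall w, 0 <= Re w -> 0 <= Re (w * (p.[w] / q.[w])).
Proof.
move=> spq q0 pq w w0.
have sq : size q = (size q).-1.+1 by rewrite prednK// (leq_trans _ spq).
set n := (size q).-1 in sq.
have spX : (size (p * 'X)%R <= n.+1)%N.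
  have [->|p0] := eqVneq p 0; first by rewrite mul0r size_poly0.
  by rewrite size_mulX// -sq.
have sq' : (size q <= n.+1)%N by rewrite sq.
pose a : {poly C} := 1 + 'X; pose b : {poly C} := 1 - 'X.
have aE z : a.[z] = 1 + z by rewrite !hornerE.
have bE z : b.[z] = 1 - z by rewrite !hornerE.
have b1 z : (b.[z] != 0) = (z != 1) by rewrite bE subr_eq0 eq_sym.
pose P := homog n (p * 'X) a b; pose Q := homog n q a b.
have PQE z : z != 1 -> P.[z] / Q.[z] =
    (1 + z) / (1 - z) * (p.[(1 + z) / (1 - z)] / q.[(1 + z) / (1 - z)]).
  rewrite -b1 => bz; rewrite /P /Q !horner_homog// aE bE.
  rewrite -mulf_div divff ?mul1r; last by rewrite expf_neq0// -bE.
  by rewrite hornerMX mulrAC mulrC.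
have Q0 z : sqn z <= 1 -> Q.[z] != 0.
  move=> z1; have [->|z1'] := eqVneq z 1.
    rewrite /Q horner_homog0 ?bE ?subrr// aE mulf_neq0 ?expf_neq0//.
    by rewrite -lead_coefE lead_coef_eq0 -size_poly_gt0 sq.
  rewrite /Q horner_homog// ?b1// mulf_neq0 ?expf_neq0 ?b1// aE bE.
  by apply: q0; have [] := cayley_half_plane_le z1 z1'.
have circ z : sqn z = 1 -> z != 1 -> 0 <= Re (P.[z] / Q.[z]).
  move=> z1 z1'; rewrite PQE//.
  have z1le : sqn z <= 1 by rewrite z1.
  have [_ /(_ z1)] := cayley_half_plane_le z1le z1'.
  move: (_ / _) => [v1 v2] /= ->; have := pq v2.
  by move: (_ / _) => [g1 g2] /=; lra.
have bound := @min_disc _ P Q 1 ler01 Q0.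
have w1 : w + 1 != 0.
  by apply/eqP => /(congr1 Re); rewrite cReD /=; lra.
pose z := (w - 1) / (w + 1).
have z1 : z != 1.
  apply/eqP => /(canRL (divfK w1)); rewrite mul1r => /(congr1 Re).
  by rewrite !cReD /=; lra.
have zw : (1 + z) / (1 - z) = w.
  have z1' : 1 - z != 0 by rewrite subr_eq0 eq_sym.
  by apply: (mulIf z1'); rewrite divfK// /z; field.
have := bound _ z; rewrite PQE// zw; apply; last first.
  have w10 := sqn_gt0 w1.
  rewrite sqnM sqnV ler_pdivrMr// mul1r.
  have -> : w - 1 = w + (-1 : R)%:C by rewrite rmorphN.
  have -> : w + 1 = w + (1 : R)%:C by [].
  by rewrite !sqnDr; lra.
move=> v v1; have [->|] := eqVneq v 1; last exact: circ.
(* z = 1 is the image of infinity: approach it along the circle *)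
have i0 : 'i%C != 0 :> C.
  by apply/eqP => /(congr1 Im) /= /eqP; rewrite oner_eq0.
pose f (t : R) : C := ('i%C%:P - 'X).[t%:C] / ('i%C%:P + 'X).[t%:C].
have cl : (f t : C^o) @[t --> (0 : R)^'+] --> (1 : C^o).
  have -> : (1 : C) = ('i%C%:P - 'X).[0] / ('i%C%:P + 'X).[0].
    by rewrite !hornerE ?subr0 ?addr0 divff.
  apply: (@cvg_horner_quot C); first by rewrite !hornerE ?addr0.
  by apply: cvg_real; apply: cvg_at_right_filter; exact: cvg_id.
have Q1 : Q.[1] != 0 by rewrite Q0// sqn1.
rewrite leNgt; apply/negP => lt0.
have Wn : \forall t \near (0 : R)^'+, Re (P.[f t] / Q.[f t]) < 0.
  exact: (cvgr_lt _ (cvg_Re_quot (p := P) Q1 cl)).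
near (0 : R)^'+ => t.
have t0 : 0 < t by near: t; exact: nbhs_right_gt.
have : Re (P.[f t] / Q.[f t]) < 0 by near: t.
have fE : f t = ('i%C - t%:C) / ('i%C + t%:C) by rewrite /f !hornerE.
have it0 : 'i%C + t%:C != 0 :> C.
  by apply/eqP => /(congr1 Im); rewrite cImD /=; lra.
rewrite ltNge => /negP; apply; apply: circ.
  rewrite fE sqnM sqnV -rmorphN !sqnDr /= sqrrN !mulr0 divff//.
  by rewrite /sqn /=; nra.
apply/eqP; rewrite fE => /(canRL (divfK it0)); rewrite mul1r => /(congr1 Re).
by rewrite !cReD /=; lra.
Unshelve. all: by end_near. Qed.

End HalfPlane.

(** * Hermitian forms *)

Section QuadraticForm.
Variables (R : realType) (m : nat).
Local Notation C := (R[i]).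
Local Notation Re := (@complex.Re R).
Local Notation Im := (@complex.Im R).
Implicit Types (A B : 'M[C]_m) (v : 'cV[C]_m) (s z : C).

Lemma conjC_conjc z : (Num.conj z) = conjc z. Proof. by []. Qed.

Definition qform v A : C := (v^t* *m A *m v) 0 0.

Lemma qformE v A : qform v A = \sum_j \sum_i (v i 0)^* * A i j * v j 0.
Proof.
rewrite /qform mxE; apply: eq_bigr => j _; rewrite mxE mulr_suml.
by apply: eq_bigr => i _; rewrite !mxE conjC_conjc.
Qed.

Lemma qformD v A B : qform v (A + B) = qform v A + qform v B.
Proof. by rewrite /qform mulmxDr mulmxDl mxE. Qed.

Lemma qformZ v c A : qform v (c *: A) = c * qform v A.
Proof. by rewrite /qform -scalemxAr -scalemxAl mxE. Qed.

Lemma qformN v A : qform v (- A) = - qform v A.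
Proof. by rewrite -scaleN1r qformZ mulN1r. Qed.

Lemma qformH v A : qform v (A^t*) = (qform v A)^*.
Proof.
rewrite !qformE rmorph_sum exchange_big /=; apply: eq_bigr => i _.
rewrite rmorph_sum; apply: eq_bigr => j _; rewrite !mxE conjC_conjc.
by rewrite !rmorphM /= conjcK mulrC mulrA mulrAC.
Qed.

Lemma qform_add_adj v A : qform v (A + A^t*) = (2 * Re (qform v A))%:C.
Proof.
rewrite qformD qformH; case: (qform v A) => a b; apply/eqP; rewrite eq_complex /=.
by apply/andP; split; apply/eqP; ring.
Qed.

Lemma qform_sub_adj v A :
  qform v ('i%C *: (A - A^t*)) = (- (2 * Im (qform v A)))%:C.
Proof.
rewrite qformZ qformD qformN qformH; case: (qform v A) => a b.
by apply/eqP; rewrite eq_complex /=; apply/andP; split; apply/eqP; ring.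
Qed.

Lemma hermsym_adj A : (A \is hermsymmx) = (A == A^t*).
Proof. by rewrite qualifE /= expr0 scale1r. Qed.

Lemma adjmxK n p (B : 'M[C]_(n, p)) : B^t*^t* = B.
Proof. by apply/matrixP => i j; rewrite !mxE !conjC_conjc conjcK. Qed.

Lemma adjmxD A B : (A + B)^t* = A^t* + B^t*.
Proof. by apply/matrixP => i j; rewrite !mxE rmorphD. Qed.

Lemma adjmxZ c A : (c *: A)^t* = c^* *: A^t*.
Proof. by apply/matrixP => i j; rewrite !mxE rmorphM. Qed.

Lemma adjmxB A B : (A - B)^t* = A^t* - B^t*.
Proof. by apply/matrixP => i j; rewrite !mxE rmorphB. Qed.

Lemma psd_add_adj A : psdmx (A + A^t*) <-> forall v, 0 <= Re (qform v A).
Proof.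
rewrite /psdmx; split=> [[_ H] v|H].
  by have := H v; rewrite -/(qform _ _) qform_add_adj ler0c pmulr_rge0.
split; first by rewrite hermsym_adj adjmxD adjmxK addrC.
by move=> v; rewrite -/(qform _ _) qform_add_adj ler0c pmulr_rge0.
Qed.

Lemma hermsym_sub_adj A : 'i%C *: (A - A^t*) \is hermsymmx.
Proof.
rewrite hermsym_adj adjmxZ -scaleN1r adjmxD adjmxZ adjmxK.
apply/eqP/matrixP => i j; rewrite !mxE !conjC_conjc.
case: (A i j) (A j i) => [a b] [c d].
by apply/eqP; rewrite eq_complex /=; apply/andP; split; apply/eqP; ring.
Qed.

Lemma psd_sub_adj A :
  psdmx ('i%C *: (A - A^t*)) <-> forall v, Im (qform v A) <= 0.
Proof.
rewrite /psdmx; split=> [[_ H] v|H].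
  by have := H v; rewrite -/(qform _ _) qform_sub_adj ler0c oppr_ge0 pmulr_rle0.
split; first exact: hermsym_sub_adj.
by move=> v; rewrite -/(qform _ _) qform_sub_adj ler0c oppr_ge0 pmulr_rle0.
Qed.

Lemma psd_opp_sub_adj A :
  psdmx (- ('i%C *: (A - A^t*))) <-> forall v, 0 <= Im (qform v A).
Proof.
rewrite /psdmx; split=> [[_ H] v|H].
  have := H v; rewrite -/(qform _ _) qformN qform_sub_adj -rmorphN opprK.
  by rewrite ler0c pmulr_rge0.
split.
  have := hermsym_sub_adj A; rewrite !hermsym_adj => /eqP AH.
  by rewrite -scaleN1r adjmxZ -AH conjC_conjc rmorphN1.
move=> v; rewrite -/(qform _ _) qformN qform_sub_adj -rmorphN opprK.
by rewrite ler0c pmulr_rge0.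
Qed.

Lemma qform_herm v A : A^t* = A -> Im (qform v A) = 0.
Proof.
move=> AE; have := qform_sub_adj v A; rewrite AE subrr scaler0.
rewrite /qform mulmx0 mul0mx mxE => /(congr1 Re) /=; lra.
Qed.

Lemma qform_det0 A : \det A = 0 -> exists2 v, v != 0 & qform v A = 0.
Proof.
move=> /eqP/det0P[u u0 uA]; exists (u^t*).
  apply: contra u0 => /eqP uE; apply/eqP/matrixP => i j.
  have := congr1 (fun M : 'cV[C]_m => (M j i)^*) uE.
  by rewrite !mxE !conjC_conjc conjcK rmorph0.
by rewrite /qform adjmxK uA mul0mx mxE.
Qed.

(** If [qform v A = 0], the form is minimal at [v]; its first variation in the
    direction [A *m v] is the squared norm of that vector, which must vanish. *)
Lemma psd_det_neq0 A v : psdmx A -> \det A != 0 -> qform v A = 0 -> v = 0.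
Proof.
move=> [AH Apsd] dA vA.
move: AH; rewrite hermsym_adj => /eqP AH.
suff Av : A *m v = 0.
  have Au : A \in unitmx by rewrite unitmxE unitfE.
  by rewrite -[v]mul1mx -(mulVmx Au) -mulmxA Av mulmx0.
pose u := A *m v.
have uE : u^t* = v^t* *m A.
  rewrite [in RHS]AH; apply/matrixP => i j; rewrite !mxE rmorph_sum.
  by apply: eq_bigr => k _; rewrite !mxE rmorphM /= mulrC.
pose N : R := \sum_j sqn (u j 0).
have NE : (u^t* *m u) 0 0 = N%:C.
  rewrite mxE rmorph_sum; apply: eq_bigr => j _.
  by rewrite !mxE conjC_conjc /= sqn_norm sqr_normc mulrC.
have key (t : R) : 0 <= t ^+ 2 * Re (qform u A) - 2 * t * N.
  have := Apsd (v - t%:C *: u).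
  have -> : (v - t%:C *: u)^t* = v^t* - t%:C *: u^t*.
    apply/matrixP => i j; rewrite !mxE !conjC_conjc rmorphB rmorphM /=.
    by rewrite oppr0.
  have -> : ((v^t* - t%:C *: u^t*) *m A *m (v - t%:C *: u)) 0 0 =
      qform v A - t%:C * (u^t* *m u) 0 0 - t%:C * (u^t* *m u) 0 0
      + t%:C * t%:C * qform u A.
    rewrite /qform !mulmxBl -!scalemxAl -uE !mulmxBr -!scalemxAr.
    have -> : u^t* *m A *m v = u^t* *m u by rewrite -mulmxA.
    by rewrite !mxE; ring.
  rewrite vA NE sub0r lecE => /andP[_] /=.
  by rewrite !(cReD, cReN, cReM) /=; lra.
have N_ge0 : 0 <= N by apply: sumr_ge0 => j _; exact: sqn_ge0.
have N0 : N = 0.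
  apply/eqP; rewrite eq_le N_ge0 andbT leNgt; apply/negP => N_gt0.
  set a := Re (qform u A) in key.
  have a1 : 0 < `|a| + 1 by rewrite ltr_wpDl.
  have := key (N / (`|a| + 1)); set t := _ / _.
  have t0 : 0 < t by rewrite divr_gt0.
  have tE : t * (`|a| + 1) = N by rewrite divfK// gt_eqF.
  have := ler_norm a => le_a.
  have : t * a <= t * `|a| by rewrite ler_pM2l.
  by nra.
apply/matrixP => j k; rewrite ord1 [RHS]mxE; apply/eqP.
have := N0; rewrite /N => /eqP.
rewrite psumr_eq0; last by move=> ? _; exact: sqn_ge0.
move=> /allP/(_ j (mem_index_enum j)) /implyP/(_ isT); apply: contraTT => uj.
by rewrite gt_eqF// sqn_gt0.
Qed.

End QuadraticForm.

(** * Analytic matrix functions *)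

Lemma near_affine (K : numFieldType) (P : K -> Prop) (a b s : K) :
  (\forall z \near (a * s + b : K^o), P z) ->
  \forall z \near (s : K^o), P (a * z + b).
Proof.
have cl : (a%:P * 'X + b%:P).[z] @[z --> (s : K^o)] -->
    ((a%:P * 'X + b%:P).[s] : K^o).
  exact: cont_horner.
have aE z : (a%:P * 'X + b%:P).[z] = a * z + b by rewrite !hornerE.
rewrite aE in cl => Pn; near=> z; rewrite -aE; near: z; exact: (cl P Pn).
Unshelve. all: by end_near. Qed.

Lemma near_derivable_affine (K : numFieldType) (I J : Type)
    (f : I -> J -> K -> K) (a b s : K) :
  (\forall z \near (a * s + b : K^o), forall i j,
    derivable (f i j : K^o -> K^o) z 1) ->
  \forall z \near (s : K^o), forall i j,
    derivable ((fun w => f i j (a * w + b)) : K^o -> K^o) z 1.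
Proof.
have df (z : K^o) : differentiable (fun w : K^o => a * w + b : K^o) z.
  apply/derivable1_diffP.
  apply: (@derivableD _ K^o K^o); last exact: derivable_cst.
  by apply: derivableM; [exact: derivable_cst|exact: derivable_id].
move=> /near_affine; apply: filterS => z fz i j; apply/derivable1_diffP.
have hg : differentiable (f i j : K^o -> K^o) (a * z + b).
  exact/derivable1_diffP.
exact: (differentiable_comp (df z) hg).
Qed.

Lemma derivable_add (K : numFieldType) (f g : K -> K) (z : K) :
  derivable (f : K^o -> K^o) z 1 -> derivable (g : K^o -> K^o) z 1 ->
  derivable ((fun w => f w + g w) : K^o -> K^o) z 1.
Proof. by move=> df dg; exact: (derivableD df dg). Qed.

Lemma derivable_addc (K : numFieldType) (e z : K) :
  derivable ((fun w => w + e) : K^o -> K^o) z 1.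
Proof.
apply: derivable_add; first exact: (@derivable_id K K^o).
exact: (@derivable_cst K K^o K^o).
Qed.

Lemma derivable_mul (K : numFieldType) (f g : K -> K) (z : K) :
  derivable (f : K^o -> K^o) z 1 -> derivable (g : K^o -> K^o) z 1 ->
  derivable ((fun w => f w * g w) : K^o -> K^o) z 1.
Proof. by move=> df dg; exact: (derivableM df dg). Qed.

Lemma near_derivable_shift (K : numFieldType) (e s : K) :
  \forall z \near (s : K^o), derivable ((fun w => w + e) : K^o -> K^o) z 1.
Proof. by apply: filterE => z; exact: derivable_addc. Qed.

Lemma near_derivable_inv_shift (K : numFieldType) (e s : K) : s + e != 0 ->
  \forall z \near (s : K^o), derivable ((fun w => (w + e)^-1) : K^o -> K^o) z 1.
Proof.
move=> se; near=> z.
have ze : z + e != 0.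
  have : ('X + e%:P).[z] != 0.
    by near: z; apply: near_horner_neq0; rewrite !hornerE.
  by rewrite !hornerE.
by apply: derivableV => //; exact: derivable_addc.
Unshelve. all: by end_near. Qed.

Section TransferFunctions.
Variables (R : realType) (m : nat).
Local Notation C := (R[i]).
Local Notation Re := (@complex.Re R).
Local Notation Im := (@complex.Im R).
Implicit Types (F G H : C -> 'M[C]_m) (D : 'M[C]_m) (v : 'cV[C]_m) (s z : C).

Lemma ratf_entry F i j : real_rational F -> ratf (fun s => F s i j).
Proof.
move=> /(_ i j)[p [q [q0 FE]]].
exists (map_poly (real_complex R) p), (map_poly (real_complex R) q).
by rewrite map_poly_eq0.
Qed.

Lemma ratf_qf F v : (forall i j, ratf (fun s => F s i j)) ->
  ratf (fun s => qform v (F s)).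
Proof.
move=> Fr; under [X in ratf X]eq_fun do rewrite qformE.
apply: ratf_sum => j; apply: ratf_sum => i.
by apply: ratfM; [apply: ratfM => //|]; exact: ratf_cst.
Qed.

Lemma cvg_qf T (E : set_system T) {FE : Filter E} v
    (H : T -> 'M[C]_m) (L : 'M[C]_m) :
  (forall i j, H t i j @[t --> E] --> (L i j : C^o)) ->
  qform v (H t) @[t --> E] --> (qform v L : C^o).
Proof.
move=> HL; rewrite qformE; under [X in X @ E]eq_fun do rewrite qformE.
apply: (@cvg_sum C) => j; apply: (@cvg_sum C) => i.
apply: (@cvgM C); last exact: cvg_cst.
by apply: (@cvgM C); [exact: cvg_cst|exact: HL].
Qed.

Lemma cont_qf F v s :
  (forall i j, continuous_at (s : C^o) (fun z => F z i j : C^o)) ->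
  continuous_at (s : C^o) (fun z => qform v (F z) : C^o).
Proof. exact: (@cvg_qf C (nbhs (s : C^o)) _ v F (F s)). Qed.

Lemma analytic_cont F s : analytic_at F s ->
  forall i j, continuous_at (s : C^o) (fun z => F z i j : C^o).
Proof.
move=> /nbhs_singleton Fs i j.
exact/differentiable_continuous/derivable1_diffP/Fs.
Qed.

Lemma analytic_affine F (a b : C) s : analytic_at F (a * s + b) ->
  analytic_at (fun z => F (a * z + b)) s.
Proof. exact: (@near_derivable_affine C _ _ (fun i j w => F w i j)). Qed.

Lemma analyticD F G s : analytic_at F s -> analytic_at G s ->
  analytic_at (fun z => F z + G z) s.
Proof.
rewrite /analytic_at => FA GA.
apply: filterS2 FA GA => z Fz Gz i j.
under [X in derivable X]eq_fun do rewrite mxE.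
exact: (@derivable_add C).
Qed.

Lemma analytic_cst D s : analytic_at (fun=> D) s.
Proof. by apply: filterE => z i j; exact: derivable_cst. Qed.

Lemma analyticZ (c : C -> C) F s :
  (\forall z \near (s : C^o), derivable (c : C^o -> C^o) z 1) ->
  analytic_at F s -> analytic_at (fun z => c z *: F z) s.
Proof.
rewrite /analytic_at => cA FA.
apply: filterS2 cA FA => z cz Fz i j.
have h := @derivable_mul C c (fun w => F w i j) z cz (Fz i j).
have -> : (fun w => (c w *: F w) i j) = (fun w => c w * F w i j).
  by apply/funext => w; rewrite mxE.
exact: h.
Qed.

Lemma analytic_tr F s : analytic_at F s -> analytic_at (fun z => (F z)^T) s.
Proof.
rewrite /analytic_at; apply: filterS => z Fz i j.
under [X in derivable X]eq_fun do rewrite mxE.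
exact: Fz.
Qed.

(** Full normal rank is witnessed at one point of analyticity; by continuity
    the determinant, a rational function, is then not the zero function. *)
Lemma generic_det H :
  (forall i j, ratf (fun s => H s i j)) -> full_normal_rank H ->
  exists2 r : {poly C}, r != 0 & forall s, r.[s] != 0 -> \det (H s) != 0.
Proof.
move=> Hr [s0 [/analytic_cont Hc d0]].
have [p [q [q0 dE]]] := ratf_det Hr.
exists (p * q) => [|s]; last first.
  rewrite hornerM mulf_eq0 negb_or => /andP[ps qs].
  by rewrite dE// mulf_neq0 ?invr_eq0.
rewrite mulf_neq0//; apply: contraNneq d0 => p0.
apply/eqP; apply: (@eq_off_roots C (fun z => \det (H z)) (fun=> 0) q s0 q0).
- exact: (@cont_det C).
- exact: cont_cst.
by apply: filterE => z /dE ->; rewrite p0 horner0 mul0r.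
Qed.

Lemma generic_conj F : real_rational F ->
  exists2 r : {poly C}, r != 0 & forall s, r.[s] != 0 ->
    forall i j, F s^*%C i j = (F s i j)^*%C.
Proof.
move=> FR.
have /choice[q] : forall ij : 'I_m * 'I_m, exists q : {poly R}, q != 0 /\
    exists p : {poly R}, forall s, horner_C q s != 0 ->
      F s ij.1 ij.2 = horner_C p s / horner_C q s.
  by move=> [i j]; have [p [q [q0 E]]] := FR i j; exists q; split=> //; exists p.
move=> qP; exists (\prod_ij map_poly (real_complex R) (q ij)).
  by apply/prodf_neq0 => ij _; rewrite map_poly_eq0; have [] := qP ij.
have hC (p : {poly R}) s : horner_C p s^*%C = (horner_C p s)^*%C.
  rewrite /horner_C -(horner_map (@conjc R)) -map_poly_comp.
  by congr (_.[_]); apply: eq_map_poly => x /=; rewrite oppr0.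
move=> s; rewrite horner_prod => /prodf_neq0 rs i j.
have [_ [p FE]] := qP (i, j).
have qs : horner_C (q (i, j)) s != 0 by exact: rs.
by rewrite !(FE _) ?hC ?conjc_eq0// rmorphM /= conjc_inv.
Qed.

Lemma imaginary_nonroot (r : {poly C}) : r != 0 ->
  exists2 w : R, 0 < w & r.[0 +i* w] != 0.
Proof.
move=> r0; pose x (k : nat) : C := 0 +i* k.+1%:R.
have x_inj : injective x.
  by move=> a b [] /eqP; rewrite eqr_nat => /eqP [].
pose rs := [seq x k | k <- iota 0 (size r)].
have [/max_poly_roots|] := boolP (all (root r) rs).
  move=> /(_ r0); rewrite map_inj_uniq// iota_uniq => /(_ isT).
  by rewrite size_map size_iota ltnn.
by move=> /allPn[_ /mapP[k _ ->] kr]; exists k.+1%:R.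
Qed.

(** At such a point [s] of the imaginary axis, [- s] is the conjugate of [s],
    so that the transposes at [- s] in the rank conditions become adjoints
    at [s]. *)
Lemma imaginary_point F H : real_rational F ->
  (forall i j, ratf (fun s => H s i j)) -> full_normal_rank H ->
  exists2 w : R, 0 < w & \det (H (0 +i* w)) != 0 /\
    F (- (0 +i* w)) = map_mx (@conjc R) (F (0 +i* w)).
Proof.
move=> FR Hr Hf.
have [r1 r10 r1E] := generic_det Hr Hf.
have [r2 r20 r2E] := generic_conj FR.
have [w w0] := imaginary_nonroot (mulf_neq0 r10 r20).
rewrite hornerM mulf_eq0 negb_or => /andP[/r1E dw /r2E cw].
exists w => //; split=> //; apply/matrixP => i j; rewrite mxE -cw.
by congr (F _ i j); apply/eqP; rewrite eq_complex /= oppr0 !eqxx.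
Qed.

End TransferFunctions.

(** * Positive real and negative imaginary functions *)

Section Properties.
Variables (R : realType) (m : nat).
Local Notation C := (R[i]).
Local Notation Re := (@complex.Re R).
Local Notation Im := (@complex.Im R).
Implicit Types (F G H : C -> 'M[C]_m) (D : 'M[C]_m) (v : 'cV[C]_m) (s z : C).

Lemma analytic_shift F (e : C) s : analytic_at F (s + e) ->
  analytic_at (fun z => F (z + e)) s.
Proof.
move=> FA; have := @analytic_affine R m F 1 e s; rewrite mul1r => /(_ FA).
by congr (analytic_at _ s); apply/funext => z; rewrite mul1r.
Qed.

Lemma analytic_unshift F (e : C) s : analytic_at (fun z => F (z - e)) (s + e) ->
  analytic_at F s.
Proof.
move=> /analytic_shift; congr (analytic_at _ s).
by apply/funext => z; rewrite addrK.
Qed.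

Lemma analytic_reflect F s :
  analytic_at F (- s) -> analytic_at (fun z => F (- z)) s.
Proof.
move=> FA; have := @analytic_affine R m F (-1) 0 s.
rewrite mulN1r addr0 => /(_ FA).
by congr (analytic_at _ s); apply/funext => z; rewrite mulN1r addr0.
Qed.

Lemma adj_of_real (A : 'M[C]_m) :
  (forall i j, Im (A i j) = 0) -> A^T = A -> A^t* = A.
Proof.
move=> Ar AT; rewrite -[RHS]AT; apply/matrixP => i j; rewrite !mxE conjC_conjc.
by have := Ar j i; case: (A j i) => a b /= ->; rewrite oppr0.
Qed.

Lemma real_of_adj (A : 'M[C]_m) i j : A^t* = A -> A^T = A -> Im (A i j) = 0.
Proof.
move=> AH AT; have := congr1 (fun B : 'M[C]_m => B j i) AH.
rewrite !mxE conjC_conjc -[in RHS]AT mxE.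
by case: (A i j) => a b /eqP; rewrite eq_complex /= => /andP[_ /eqP]; lra.
Qed.

Lemma adj_tr (A : 'M[C]_m) : A^T = A -> A^t* = map_mx (@conjc R) A.
Proof.
by move=> AT; apply/matrixP => i j; rewrite -[in RHS]AT !mxE conjC_conjc.
Qed.

Section PositiveReal.
Variables (F : C -> 'M[C]_m) (e : R).
Hypotheses (Fsym : symmetric_tf F) (FR : real_rational F).
Hypothesis (Fpr : C_PR (fun s => F (s - e%:C))).

Let Re_shift s : - e < Re s -> 0 < Re (s + e%:C).
Proof. by rewrite cReD /= => h; lra. Qed.

Lemma PR_analytic s : - e < Re s -> analytic_at F s.
Proof. by case: Fpr => FA _ _ /Re_shift/FA; exact: analytic_unshift. Qed.

Lemma PR_real s : - e < Re s -> Im s = 0 -> (F s)^t* = F s.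
Proof.
case: Fpr => _ Fr _ /Re_shift; case: s => a b /= ae b0; subst b.
apply: adj_of_real; last exact: Fsym.
move=> i j; have := Fr _ ae i j; congr (Im (F _ _ _) = _).
by apply/eqP; rewrite eq_complex /= subr0 addrK !eqxx.
Qed.

Lemma PR_Re_ge0 s v : - e < Re s -> 0 <= Re (qform v (F s)).
Proof.
case: Fpr => _ _ Fp /Re_shift/Fp; rewrite addrK => /psd_add_adj; exact.
Qed.

(** For a fixed vector, the form is a scalar positive real function of
    [s + e], real on the real axis because [F] is real and symmetric there. *)
Lemma PR_angle s v : - e < Re s ->
  (Re s + e) * `|Im (qform v (F s))| <= `|Im s| * Re (qform v (F s)).
Proof.
move=> se; have Fr i j := ratf_entry i j FR.
have [|p [q [r [r0 pqE]]]] := @ratf_reduce C _ (fun z => - e < Re z) (ratf_qf v Fr).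
  by move=> z /PR_analytic/analytic_cont; exact: cont_qf.
pose t : {poly C} := 'X - (e%:C)%:P.
have tE w : t.[w] = w - e%:C by rewrite !hornerE.
have gE w : 0 < Re w -> (q \Po t).[w] != 0 /\
    (p \Po t).[w] / (q \Po t).[w] = qform v (F (w - e%:C)).
  move=> w0; rewrite !horner_comp tE.
  have [|qw ->//] := pqE (w - e%:C).
  by right; rewrite cReD cReN /=; lra.
have := @positive_real_angle _ (p \Po t) (q \Po t) _ _ (s + e%:C) (Re_shift se).
rewrite (gE _ (Re_shift se)).2 addrK cReD cImD /= addr0; apply.
  move=> w w0; have [qw ->] := gE _ w0; split=> //; apply: PR_Re_ge0.
  by rewrite cReD cReN /=; lra.
move=> x x0; rewrite (gE _ _).2//; apply: qform_herm; apply: PR_real => /=.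
  by lra.
by rewrite subr0.
Qed.

End PositiveReal.

Section NegativeImaginary.
Variables (G : C -> 'M[C]_m) (e : R).
Hypothesis (Gni : C_NI (fun s => G (s - e%:C))).

Let Re_shift s : - e < Re s -> 0 < Re (s + e%:C).
Proof. by rewrite cReD /= => h; lra. Qed.

Lemma NI_analytic s : - e < Re s -> analytic_at G s.
Proof. by case: Gni => GA _ /Re_shift/GA; exact: analytic_unshift. Qed.

Lemma NI_real s : - e < Re s -> Im s = 0 -> (G s)^t* = G s.
Proof.
case: Gni => _ H /Re_shift/H; rewrite addrK cImD addr0 => -[_ H0 _] /H0.
move=> /(congr1 (fun A => - 'i%C *: A)).
rewrite scaler0 scalerA mulNr -expr2 sqr_i opprK scale1r.
by move=> /subr0_eq.
Qed.

Lemma NI_Im s v : - e < Re s -> Im s * Im (qform v (G s)) <= 0.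
Proof.
move=> se; have [s0|s0|s0] := ltgtP (Im s) 0; last by rewrite s0 mul0r.
  case: Gni => _ /(_ _ (Re_shift se)); rewrite addrK cImD addr0 => -[_ _ /(_ s0)].
  by move=> /psd_opp_sub_adj/(_ v) h; nra.
case: Gni => _ /(_ _ (Re_shift se)); rewrite addrK cImD addr0 => -[/(_ s0)].
by move=> /psd_sub_adj/(_ v) h _ _; nra.
Qed.

End NegativeImaginary.
End Properties.

(** * The value at infinity *)

Section Infinity.
Variables (R : realType) (m : nat).
Local Notation C := (R[i]).
Local Notation Re := (@complex.Re R).
Local Notation Im := (@complex.Im R).
Variables (G : C -> 'M[C]_m) (e : R).
Hypotheses (Gsym : symmetric_tf G) (GR : real_rational G) (Gpr : proper_tf G).
Hypothesis (Gni : C_NI (fun s => G (s - e%:C))).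
Hypothesis (e0 : 0 < e).
Local Notation L := (value_at_infty G).

Lemma cvg_value_at_infty i j : G z^-1 i j @[z --> (0 : C^o)^'] --> (L i j : C^o).
Proof. by rewrite mxE; exact: Gpr. Qed.

Lemma value_at_infty_sym : L^T = L.
Proof.
apply/matrixP => i j; rewrite !mxE.
suff -> : (fun z => G z^-1 j i) = (fun z => G z^-1 i j) by [].
by apply/funext => z; rewrite -[in LHS]Gsym mxE.
Qed.

(** Approach infinity along the positive reals, where a symmetric negative
    imaginary function is real. *)
Lemma value_at_infty_real i j : Im (L i j) = 0.
Proof.
have c0 : (t%:C : C^o) @[t --> (0 : R)^'+] --> (0 : C^o)^'.
  have c0 : (t%:C : C^o) @[t --> (0 : R)^'+] --> (0%:C : C^o).
    by apply: cvg_real; apply: cvg_at_right_filter; exact: cvg_id.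
  move=> A /c0 An; suff : \forall t \near (0 : R)^'+, A t%:C by [].
  have {}An : \forall t \near (0 : R)^'+, t%:C != 0 :> C -> A t%:C by exact: An.
  near=> t.
  have t0 : 0 < t by near: t; exact: nbhs_right_gt.
  have : t%:C != 0 :> C.
    by rewrite -(rmorph0 (real_complex R)) (inj_eq (@complexI R)) gt_eqF.
  by near: t.
have : Im (G (t%:C)^-1 i j) @[t --> (0 : R)^'+] --> Im (L i j).
  by apply: cvg_Im; move=> A /(@cvg_value_at_infty i j) /c0.
have : Im (G (t%:C)^-1 i j) @[t --> (0 : R)^'+] --> (0 : R).
  have cc : (fun=> (0 : R)) @ (0 : R)^'+ --> (0 : R) by exact: cvg_cst.
  apply: cvg_trans cc; apply: near_eq_cvg; near=> t.
  have t0 : 0 < t by near: t; exact: nbhs_right_gt.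
  have tV : (t%:C)^-1 = (t^-1)%:C :> C by rewrite fmorphV.
  have te : - e < t^-1.
    by apply: (lt_trans (y := 0)); rewrite ?oppr_lt0 ?invr_gt0.
  rewrite tV (real_of_adj _ _ _ (Gsym _))//.
  exact: (NI_real Gni).
by move=> l1 l2; exact: (cvg_unique (@norm_hausdorff R R) l2 l1).
Unshelve. all: by end_near. Qed.

Lemma value_at_infty_adj : L^t* = L.
Proof. exact: adj_of_real value_at_infty_real value_at_infty_sym. Qed.

Lemma qform_infty_Im v s : Im (qform v (G s - L)) = Im (qform v (G s)).
Proof.
by rewrite qformD qformN cImD cImN (qform_herm _ value_at_infty_adj) oppr0 addr0.
Qed.

Lemma ratf_sub_infty i j : ratf (fun s => (G s - L) i j).
Proof.
under [X in ratf X]eq_fun do rewrite !mxE.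
by apply: ratfD; [exact: ratf_entry|exact: ratf_cst].
Qed.

(** For every [d < e] the function [(s + d) * (G s - L)] is positive real on
    [- d <= Re s]: with [w = s + d], the form of [G - L] vanishes at infinity
    and the sign of its imaginary part on the imaginary axis is known. *)
Lemma NI_Re_ge0 v (d : R) s : d < e -> - d <= Re s ->
  0 <= Re ((s + d%:C) * qform v (G s - L)).
Proof.
move=> de sd.
have [|p [q [r [r0 pqE]]]] := @ratf_reduce C _ (fun z => - e < Re z)
    (@ratf_qf R m (fun s => G s - L) v ratf_sub_infty).
  move=> z /(NI_analytic Gni)/analytic_cont Gc; apply: cont_qf => i j.
  under [X in continuous_at _ X]eq_fun do rewrite mxE.
  by apply: contD; [exact: Gc|exact: cont_cst].
have h0 : qform v (G z^-1 - L) @[z --> (0 : C^o)^'] --> (qform v (L - L) : C^o).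
  apply: cvg_qf => i j; under [X in X @ _]eq_fun do rewrite mxE.
  have -> : (L - L) i j = L i j + (- L) i j by rewrite mxE.
  by apply: (@cvg_addc C); exact: cvg_value_at_infty.
rewrite [X in _ --> (X : C^o)](_ : _ = 0) in h0; last first.
  by rewrite subrr /qform mulmx0 mul0mx mxE.
have spq : (size p < size q)%N.
  apply: (@size_ratf_infty C (fun s => qform v (G s - L)) p q r r0) => // z rz.
  by apply: pqE; left.
pose t : {poly C} := 'X - (d%:C)%:P.
have tE w : t.[w] = w - d%:C by rewrite !hornerE.
have st : size t = 2 by exact: size_XsubC.
have gE w : 0 <= Re w -> (q \Po t).[w] != 0 /\
    (p \Po t).[w] / (q \Po t).[w] = qform v (G (w - d%:C) - L).
  move=> w0; rewrite !horner_comp tE.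
  have [|qw ->//] := pqE (w - d%:C).
  by right; rewrite cReD cReN /=; lra.
have sd0 : 0 <= Re (s + d%:C) by rewrite cReD /=; lra.
have := @positive_on_half_plane _ (p \Po t) (q \Po t) _ _ _ (s + d%:C) sd0.
rewrite (gE _ sd0).2 addrK; apply.
- by rewrite !size_comp_poly2.
- by move=> w /gE[].
move=> b; rewrite (gE _ _).2 ?lexx// qform_infty_Im.
have := @NI_Im _ _ _ _ Gni (0 +i* b - d%:C) v.
rewrite cReD cReN cImD cImN /= oppr0 addr0; apply; lra.
Qed.

End Infinity.

(** * The two correspondences *)

Section Main.
Variables (R : realType) (m : nat).
Local Notation C := (R[i]).
Local Notation Re := (@complex.Re R).
Local Notation Im := (@complex.Im R).

(** With [f] the form of [F] at a vector, the imaginary part of [f / (s + d)]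
    has the sign of [(Re s + d) * Im f - Im s * Re f], and [PR_angle] at the
    larger shift [e] decides it.  Since [d < e] strictly, it can vanish on the
    imaginary axis only if [Re f = 0], which the rank condition on [F]
    excludes at a generic point. *)
Lemma SSPR_to_SSNI (F : C -> 'M[C]_m) :
  symmetric_tf F -> real_rational F -> C_SSPR F ->
  exists2 eps : R, 0 < eps &
    forall D : 'M[R]_m, D^T = D ->
      C_SSNI (fun s => (s + eps%:C)^-1 *: F s + map_mx (real_complex R) D).
Proof.
move=> Fsym FR [_ [e e0 Fpr] Fn].
have [d d0 de] : exists2 d : R, 0 < d & e = 2 * d.
  by exists (e / 2); [rewrite divr_gt0|field].
(* d must be smaller than e: for F s = s + e, F s / (s + e) is constant *)
exists d => // D DT; pose Dc := map_mx (real_complex R) D.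
pose G s := (s + d%:C)^-1 *: F s + Dc.
have DcT : Dc^T = Dc by rewrite /Dc map_trmx DT.
have DcH : Dc^t* = Dc by apply: adj_of_real => // i j; rewrite mxE.
have GA s : - d < Re s -> analytic_at G s.
  move=> sd; apply: analyticD; last exact: analytic_cst.
  apply: analyticZ; last by apply: (PR_analytic Fpr); lra.
  apply: (@near_derivable_inv_shift C); apply/eqP => /(congr1 Re).
  by rewrite cReD /=; lra.
have GR : real_rational G.
  move=> i j; have [p [q [q0 FE]]] := FR i j.
  exists (p + (D i j)%:P * (('X + d%:P) * q)), (('X + d%:P) * q); split.
    by rewrite mulf_neq0// -size_poly_gt0 size_XaddC.
  move=> s; rewrite /horner_C !(rmorphD, rmorphM) /= !map_polyX !map_polyC /=.
  rewrite !(hornerM, hornerD, hornerC, hornerX) mulf_eq0 negb_or => /andP[sd qs].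
  rewrite /G !mxE FE// /horner_C. field.
  by rewrite qs sd.
have Im_G s v : s + d%:C != 0 -> sqn (s + d%:C) * Im (qform v (G s)) =
    (Re s + d) * Im (qform v (F s)) - Im s * Re (qform v (F s)).
  move=> sd; rewrite qformD qformZ cImD (qform_herm v DcH) addr0.
  move: (qform v (F s)) => f.
  have fE : f = (s + d%:C) * ((s + d%:C)^-1 * f) by rewrite mulVKf.
  rewrite [in RHS]fE; move: (_^-1 * f) => g.
  rewrite cReM cImM /sqn !cReD !cImD /=; ring.
split=> //.
  exists d => //; split=> [s s0|s s0].
    apply: (@analytic_shift _ _ G); apply: GA.
    by rewrite cReD cReN /=; lra.
  have sd : - d < Re (s - d%:C) by rewrite cReD cReN /=; lra.
  have se : - e < Re (s - d%:C) by lra.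
  set z := s - d%:C in sd se *.
  have zs : Im z = Im s by rewrite cImD cImN /= oppr0 addr0.
  have zd : z + d%:C != 0.
    by apply/eqP => /(congr1 Re); rewrite cReD /=; lra.
  have zd0 := sqn_gt0 zd.
  have angle v := PR_angle Fsym FR Fpr v se.
  have pos v := PR_Re_ge0 Fpr v se.
  have key v : (Re z + d) * `|Im (qform v (F z))| <= `|Im z| * Re (qform v (F z)).
    by apply: le_trans (angle v); rewrite ler_wpM2r//; lra.
  rewrite -zs; split=> [z0|z0|z0].
  - apply/psd_sub_adj => v; rewrite -(pmulr_rle0 _ zd0) Im_G//.
    have := key v; rewrite (gtr0_norm z0) => kv.
    have := ler_norm (Im (qform v (F z))) => nv.
    have : (Re z + d) * Im (qform v (F z)) <= (Re z + d) * `|Im (qform v (F z))|.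
      by rewrite ler_pM2l//; lra.
    by lra.
  - have Fz := PR_real Fsym Fpr se z0.
    suff -> : G z ^t* = G z by rewrite subrr scaler0.
    rewrite adjmxD adjmxZ Fz DcH; congr (_ *: _ + _).
    rewrite conjC_conjc conjc_inv; congr (_^-1).
    apply/eqP; rewrite eq_complex; move: z0; case: (z) => a b /= ->.
    by rewrite !addr0 oppr0 !eqxx.
  apply/psd_opp_sub_adj => v; rewrite -(pmulr_rge0 _ zd0) Im_G//.
  have := key v; rewrite (ltr0_norm z0) => kv.
  have := ler_norm (- Im (qform v (F z))); rewrite normrN => nv.
  have : (Re z + d) * - Im (qform v (F z)) <= (Re z + d) * `|Im (qform v (F z))|.
    by rewrite ler_pM2l//; lra.
  by lra.
have Hr i j : ratf (fun s => (F s + (F (- s))^T) i j).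
  under [X in ratf X]eq_fun do rewrite !mxE.
  apply: ratfD; first exact: ratf_entry.
  exact: (ratf_opp (ratf_entry j i FR)).
have [w w0 [dw Fw]] := imaginary_point FR Hr Fn.
set s : C := 0 +i* w in dw Fw.
have Fadj : (F (- s))^T = (F s)^t* by rewrite Fsym Fw adj_tr.
have sd : - d < Re s by rewrite /=; lra.
have se : - e < Re s by rewrite /=; lra.
have Gadj : (G (- s))^T = (G s)^t*.
  rewrite adjmxD adjmxZ DcH -Fadj /G linearD linearZ /= DcT; congr (_ *: _ + _).
  rewrite conjC_conjc conjc_inv; congr (_^-1).
  by apply/eqP; rewrite eq_complex /= !oppr0 !add0r !addr0 !eqxx.
exists s; split.
  apply: analyticZ.
    by apply: filterE => z; exact: (@derivable_cst C C^o C^o).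
  apply: analyticD; first exact: GA.
  have -> : (fun z => - (G (- z))^T) = (fun z => -1 *: (G (- z))^T).
    by apply/funext => z; rewrite scaleN1r.
  apply: analyticZ.
    by apply: filterE => z; exact: (@derivable_cst C C^o C^o).
  apply: analytic_tr; apply: (@analytic_reflect _ _ G); apply: GA.
  by rewrite /= oppr0; lra.
rewrite -/(G s) -/(G (- s)) Gadj; apply/eqP => /qform_det0[v v0].
rewrite qform_sub_adj => /(congr1 Re) /= Im0.
have sd0 : s + d%:C != 0 by apply/eqP => /(congr1 Re); rewrite cReD /=; lra.
have := Im_G s v sd0; have -> : Im (qform v (G s)) = 0 by lra.
have := PR_angle Fsym FR Fpr v se; have := PR_Re_ge0 Fpr v se.
rewrite /= !add0r (gtr0_norm w0); set f := qform v (F s) => f0 angle Eq.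
have Ref : Re f = 0.
  have h1 := ler_norm (Im f).
  have h2 : d * Im f <= d * `|Im f| by rewrite ler_pM2l.
  have h3 : w * Re f <= 0 by rewrite de in angle; lra.
  by apply/eqP; rewrite eq_le f0 andbT -(pmulr_rle0 _ w0).
move: v0; rewrite (@psd_det_neq0 _ _ _ v _ dw) ?eqxx//.
  by rewrite Fadj; apply/psd_add_adj => u; exact: (PR_Re_ge0 Fpr).
by rewrite Fadj qform_add_adj -/f Ref mulr0.
Qed.

(** With [h] the form of [G - L] at a vector, the real part of [(i w + d) h]
    is [d * Re h - w * Im h].  The same expression with [2 * d] for [d] and
    with 0 for [d] is nonnegative, so that it can vanish only if [Im h = 0],
    which the rank condition on [G] excludes at a generic point. *)
Lemma SSNI_to_SSPR (G : C -> 'M[C]_m) :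
  symmetric_tf G -> real_rational G -> proper_tf G -> C_SSNI G ->
  exists2 eps : R, 0 < eps &
    C_SSPR (fun s => (s + eps%:C) *: (G s - value_at_infty G)).
Proof.
move=> Gsym GR Gpr [_ [e e0 Gni] Gn].
have [d d0 de] : exists2 d : R, 0 < d & e = 4 * d.
  by exists (e / 4); [rewrite divr_gt0|field].
have d2e : 2 * d < e by lra.
have dle : d < e by lra.
exists d => //; set L := value_at_infty G.
pose F s := (s + d%:C) *: (G s - L).
have LH : L^t* = L by exact: (value_at_infty_adj Gsym Gpr Gni e0).
have LT : L^T = L by exact: value_at_infty_sym.
have pos v s (c : R) := @NI_Re_ge0 _ _ _ _ Gsym GR Gpr Gni e0 v c s.
have FA s : - e < Re s -> analytic_at F s.
  move=> se; apply: analyticZ; first exact: (@near_derivable_shift C).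
  by apply: analyticD; [exact: (NI_analytic Gni)|exact: analytic_cst].
have FR : real_rational F.
  move=> i j; have [p [q [q0 GE]]] := GR i j.
  exists (('X + d%:P) * (p - (Re (L i j))%:P * q)), q; split=> // s qs.
  have -> : F s i j = (s + d%:C) * (G s i j - (Re (L i j))%:C).
    rewrite /F !mxE; congr (_ * (_ - _)).
    have := value_at_infty_real Gsym Gpr Gni e0 i j; rewrite mxE.
    by case: (lim _) => a b /= ->.
  rewrite GE//; move: qs; rewrite /horner_C.
  rewrite !(rmorphB, rmorphD, rmorphM) /= !map_polyX !map_polyC /=.
  rewrite !(hornerM, hornerD, hornerN, hornerC, hornerX) => qs.
  by field.
have Fpos s v : - d <= Re s -> 0 <= Re (qform v (F s)).
  by move=> sd; rewrite qformZ; exact: pos.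
split=> //.
  exists d => //; split=> [s s0|x x0 i j|s s0].
  - apply: (@analytic_shift _ _ F); apply: FA.
    by rewrite cReD cReN /=; lra.
  - have xE : x%:C - d%:C = (x - d)%:C :> C by rewrite rmorphB.
    have xe : - e < Re (x%:C - d%:C) by rewrite xE /=; lra.
    have := NI_real Gni xe; rewrite {1}xE => /(_ erefl) Gx.
    have : (F (x%:C - d%:C))^t* = F (x%:C - d%:C).
      by rewrite /F adjmxZ adjmxB LH Gx conjC_conjc subrK conjc_real.
    move=> /real_of_adj; apply.
    by rewrite /F linearZ linearB /= Gsym LT.
  apply/psd_add_adj => v; apply: Fpos.
  by rewrite cReD cReN /=; lra.
have Hr i j : ratf (fun s => ('i%C *: (G s - (G (- s))^T)) i j).
  under [X in ratf X]eq_fun do rewrite !mxE -mulN1r.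
  apply: ratfM; first exact: ratf_cst.
  apply: ratfD; first exact: ratf_entry.
  apply: ratfM; first exact: ratf_cst.
  exact: (ratf_opp (ratf_entry j i GR)).
have [w w0 [dw Gw]] := imaginary_point GR Hr Gn.
set s : C := 0 +i* w in dw Gw.
have Gadj : (G (- s))^T = (G s)^t* by rewrite Gsym Gw adj_tr.
have se : - e < Re s by rewrite /=; lra.
have Fadj : (F (- s))^T = (F s)^t*.
  rewrite adjmxZ adjmxB LH -Gadj /F linearZ linearB /= LT conjC_conjc.
  congr (_ *: _).
  by apply/eqP; rewrite eq_complex /= !oppr0 !add0r !addr0 !eqxx.
exists s; split.
  apply: analyticD; first exact: FA.
  apply: analytic_tr; apply: (@analytic_reflect _ _ F); apply: FA.
  by rewrite /= oppr0; lra.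
rewrite -/(F s) -/(F (- s)) Fadj; apply/eqP => /qform_det0[v v0].
rewrite qform_add_adj qformZ => /(congr1 Re) /=; rewrite cReM.
have sd : - (2 * d) <= Re s by rewrite /=; lra.
have := pos v s _ d2e sd; rewrite cReM.
have := NI_Im Gni v se; rewrite -(qform_infty_Im Gsym Gpr Gni e0) -/L.
set h := qform v (G s - L).
rewrite !cReD !cImD /= !add0r !addr0 => Imh pos2 eq0.
have hIm : Im h = 0.
  have : w * Im h = 0 by lra.
  by move=> /eqP; rewrite mulf_eq0 (gt_eqF w0) /= => /eqP.
move: v0; rewrite (@psd_det_neq0 _ _ _ v _ dw) ?eqxx//.
  rewrite Gadj; apply/psd_sub_adj => u.
  by have := NI_Im Gni u se; rewrite pmulr_rle0.
rewrite Gadj qform_sub_adj -(qform_infty_Im Gsym Gpr Gni e0) -/L -/h hIm.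
by rewrite mulr0 oppr0.
Qed.

End Main.

Theorem lemma8 (R : realType) (m : nat) :
  (forall F : R[i] -> 'M[R[i]]_m,
     symmetric_tf F -> real_rational F -> C_SSPR F ->
     exists2 eps : R, 0 < eps &
       forall D : 'M[R]_m, D^T = D ->
         C_SSNI (fun s : R[i] =>
           (s + eps%:C)^-1 *: F s + map_mx (real_complex R) D))
  /\
  (forall G : R[i] -> 'M[R[i]]_m,
     symmetric_tf G -> real_rational G -> proper_tf G -> C_SSNI G ->
     exists2 eps : R, 0 < eps &
       C_SSPR (fun s : R[i] =>
         (s + eps%:C) *: (G s - value_at_infty G))).
Proof. by split; [exact: SSPR_to_SSNI|exact: SSNI_to_SSPR]. Qed.
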